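(* Let $B$ be the Brjuno function and let $h^1_B(x_0)$ denote its $1$-exponent at $x_0\in\mathbb{R}$. If $x_0\in\mathbb{Q}$, then $h^1_B(x_0)=0$. If $x_0\notin\mathbb{Q}$, then \[ h^1_B(x_0)=\frac{1}{\tau(x_0)},\] where $\tau(x_0)$ is the irrationality exponent of $x_0$ (with the convention $1/(+\infty)=0$).
   Context: For an irrational $x\in(0,1)$ with continued fraction expansion $x=[0;a_1,a_2,\ldots]$ and convergents $p_n/q_n$, with the conventions $(p_{-1},q_{-1})=(1,0)$, $(p_0,q_0)=(0,1)$, the Brjuno function is \[ B(x)=\sum_{n=0}^{\infty}|p_{n-1}-q_{n-1}x|\,\log\left(\frac{|p_{n-1}-q_{n-1}x|}{|q_nx-p_n|}\right)\in[0,+\infty] \] (the $n=0$ term is $\log(1/x)$), extended to all irrational reals by $1$-periodicity. $B$ is finite almost everywhere and belongs to $L^p_{loc}(\mathbb{R})$ for every $p\in[1,\infty)$. For $p\in[1,\infty)$, $\alpha\ge -1/p$, $f\in L^p_{loc}(\mathbb{R})$, $x_0\in\mathbb{R}$: $f\in T^p_\alpha(x_0)$ if there exist $C>0$ and a polynomial $P$ of degree less than $\alpha$ ($P\equiv0$ if $\alpha<0$) such that for all sufficiently small $\rho>0$, $\left(\frac{1}{2\rho}\int_{x_0-\rho}^{x_0+\rho}|f(x)-P(x-x_0)|^p\,dx\right)^{1/p}\le C\rho^\alpha$. The $p$-exponent is $h^p_f(x_0)=\sup\{\alpha: f\in T^p_\alpha(x_0)\}$. For irrational $x_0$ with convergents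 $p_n/q_n$, define $\tau_n(x_0)$ by $|x_0-p_n/q_n|=q_n^{-\tau_n(x_0)}$; the irrationality exponent is $\tau(x_0)=\limsup_{n\to\infty}\tau_n(x_0)\in[2,+\infty]$. *)

(* Defs.v *)
From HB Require Import structures.
From mathcomp Require Import all_boot all_order all_algebra.
From mathcomp Require Import all_classical all_reals all_analysis.
From mathcomp Require Import measurable_realfun.
Import Order.TTheory GRing.Theory Num.Theory.
Import numFieldNormedType.Exports.

Set Implicit Arguments.
Unset Strict Implicit.
Unset Printing Implicit Defensive.

Local Open Scope classical_set_scope.
Local Open Scope ring_scope.

Section continued_fraction.
Context {R : realType}.
Implicit Types (x : R) (n : nat).

Definition fracpart x : R := x - (Num.floor x)%:~R.

(* Iterates of the Gauss map: x = [a_0; a_1, ..., a_n + cf_rest x n]. *)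
Definition cf_rest x n : R := iter n (fun y => fracpart y^-1) (fracpart x).

(* For irrational x this is the regular expansion x = [a_0; a_1, a_2, ...],
   with a_0 = floor x (so a_0 = 0 when 0 < x < 1). *)
Definition cf_digit x n : int :=
  if n is m.+1 then Num.floor (cf_rest x m)^-1 else Num.floor x.

(* Indices are shifted by one: cf_num x n and cf_den x n are p_(n-1) and
   q_(n-1), so that (p_(-1), q_(-1)) = (1, 0) sits at index 0. *)
Fixpoint cf_num x n : int :=
  match n with
  | 0 => 1
  | m.+1 => match m with
            | 0 => cf_digit x 0
            | k.+1 => cf_digit x m * cf_num x m + cf_num x k
            end
  end.

Fixpoint cf_den x n : int :=
  match n with
  | 0 => 0
  | m.+1 => match m with
            | 0 => 1
            | k.+1 => cf_digit x m * cf_den x m + cf_den x k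
            end
  end.

(* cf_err x n = |p_(n-1) - q_(n-1) x|. *)
Definition cf_err x n : R := `|(cf_num x n)%:~R - (cf_den x n)%:~R * x|.

Definition brjuno01 x : \bar R :=
  (\sum_(0 <= n <oo) (cf_err x n * ln (cf_err x n / cf_err x n.+1))%:E)%E.

(* The value 0 on the rationals, where the Brjuno function is not defined, is
   a placeholder on a null set. *)
Definition brjuno x : \bar R :=
  if x \in irrational then brjuno01 (fracpart x) else 0%E.

(* The solution t of |x - p_n / q_n| = q_n `^ (- t), which is unique as soon
   as q_n > 1, in particular for all n >= 2. *)
Definition cf_tau x n : R :=
  - (ln `|x - (cf_num x n.+1)%:~R / (cf_den x n.+1)%:~R| /
     ln (cf_den x n.+1)%:~R).

Definition irrationality_exponent x : \bar R :=
  limn_esup (fun n => (cf_tau x n)%:E).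

End continued_fraction.

Section p_exponent.
Context {R : realType}.
Implicit Types (p alpha : R) (f : R -> \bar R).
Local Notation mu := (@lebesgue_measure R).
Local Open Scope ereal_scope.

Definition Lp_loc p f : Prop :=
  measurable_fun [set: R] f /\
  forall K : set R, compact K -> \int[mu]_(x in K) (`|f x| `^ p) < +oo.

(* The disjunction on P reads deg P < alpha where the zero polynomial has degree
   -oo; in particular it forces P = 0 when alpha <= 0. *)
Definition Tspace p alpha (x0 : R) f : Prop :=
  [/\ Lp_loc p f,
      (- p^-1 <= alpha)%R &
      exists (C : R) (P : {poly R}),
        [/\ (0 < C)%R,
            P = 0%R \/ ((size P).-1%:R < alpha)%R &
            \forall rho \near 0%R^'+,
              (((2 * rho)^-1)%:E *
               \int[mu]_(x in `[(x0 - rho)%R, (x0 + rho)%R])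
                  (`|f x - (P.[x - x0])%:E| `^ p)) `^ p^-1
              <= (C * rho `^ alpha)%:E]].

Definition p_exponent p f (x0 : R) : \bar R :=
  ereal_sup [set alpha%:E | alpha in [set alpha : R | Tspace p alpha x0 f]].

End p_exponent.

(* Main.v *)
(* Write e_j = |p_(j-1) - q_(j-1) x|.  The Brjuno function is the sum of the
   terms t_j = e_j ln (e_j / e_(j+1)), and t_j is at most (1/q) ln (1/(q^2 d))
   where q = q_j and d = |x - p_j/q_j|.  Fractions with denominators in
   [D, 2D) are separated by 1/(4 D^2), so summing the integrals of these
   logarithms over dyadic D shows that on an interval of length l the tail of
   the series over denominators at least Q has mean O((1 + ln^+ (1/(Q^2 l)))/Q);
   no change of variables under the Gauss map is needed.  On points sharing
   the digits up to q_m, the partial sum of the t_j is Lipschitz with constant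
   O(1/e_m).

   Near x0, with k chosen so that |x0 - p_k/q_k| > 4 rho >= |x0 - p_(k+1)/q_(k+1)|,
   these two bounds give a mean deviation from B(x0) of order
   rho q_(k+1) + ln(1/rho)/q_(k+1) plus the tail of the series at x0, which is
   O(rho^alpha) for every alpha < 1/tau.  Conversely, on one side of p_n/q_n and
   at distance at most a small multiple of q_n^-2, the function is
   t_n + (Lipschitz part) + (small tail), and the logarithmic singularity of t_n
   makes the mean oscillation at least a constant times 1/q_n.  At
   rho = 2|x0 - p_n/q_n| = 2 q_n^-tau_n this excludes every alpha > 1/tau; when
   x0 = p_n/q_n is rational it excludes every alpha > 0. *)

Require Import Defs.
From HB Require Import structures.
From mathcomp Require Import all_boot all_order all_algebra.
From mathcomp Require Import all_classical all_reals all_analysis.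
From mathcomp Require Import measurable_realfun.
From mathcomp Require Import ring lra zify.
Import Order.TTheory GRing.Theory Num.Theory.
Import numFieldNormedType.Exports.
Local Open Scope classical_set_scope.
Local Open Scope ring_scope.

(** * Convergents and their errors *)

Section continued_fraction_facts.
Context {R : realType}.
Implicit Types (x y : R) (k m n : nat).

Lemma fracpart_itv x : 0 <= fracpart x < 1.
Proof.
rewrite /fracpart subr_ge0 floor_le/= ltrBlDr addrC.
by have := floorD1_gt x; rewrite intrD.
Qed.

Lemma fracpart_id x : 0 <= x < 1 -> fracpart x = x.
Proof.
move=> x01; rewrite /fracpart; suff -> : Num.floor x = 0 by rewrite subr0.
by apply: floor_def; rewrite mulr0z add0r mulr1z.
Qed.

Lemma cf_rest_itv x k : 0 <= cf_rest x k < 1.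
Proof. by case: k => [|k]; exact: fracpart_itv. Qed.

Lemma cf_rest_fracpart x : cf_rest (fracpart x) =1 cf_rest x.
Proof. by move=> k; rewrite /cf_rest (fracpart_id _ (fracpart_itv x)). Qed.

Lemma rationalDint x (a : int) : rational (x + a%:~R) -> rational x.
Proof.
move=> [q _ E]; exists (q - a%:~R) => //.
transitivity ((ratr q : R) - a%:~R).
  by rewrite rmorphB/=; congr (_ - _); exact: ratr_int.
by apply/eqP; rewrite subr_eq; apply/eqP; exact: E.
Qed.

Lemma rationalV x : rational x^-1 -> rational x.
Proof.
move=> [q _ E]; exists (q^-1) => //.
by rewrite fmorphV -[RHS]invrK; congr (_^-1); exact: E.
Qed.

Lemma rational0 : rational (0 : R).
Proof. by exists 0 => //; rewrite rmorph0. Qed.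

Lemma irrational_fracpart x : irrational x -> irrational (fracpart x).
Proof. by move=> ix H; apply: ix; move: H; rewrite /fracpart -mulrNz => /rationalDint. Qed.

Lemma irrational_cf_rest x k : irrational x -> irrational (cf_rest x k).
Proof.
move=> ix; elim: k => [|k IH]; first exact: irrational_fracpart.
by apply: irrational_fracpart => /rationalV.
Qed.

(** The expansion has not stopped before step [n]. Under this condition the facts on convergents
    cover rational points up to their last convergent, and irrational points at every index. *)
Definition cf_good x n := forall j, (j < n)%N -> 0 < cf_rest x j.

Lemma irrational_good x n : irrational x -> cf_good x n.
Proof.
move=> ix j _; have /andP[r0 _] := cf_rest_itv x j; rewrite lt_neqAle r0 andbT.
by apply/eqP => E; apply: (irrational_cf_rest x j ix); rewrite -E; exact: rational0.
Qed.

Lemma cf_good_sub x m n : (m <= n)%N -> cf_good x n -> cf_good x m.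
Proof. by move=> mn g j jm; apply: g; exact: leq_trans jm mn. Qed.

Lemma cf_digit_ge1 x k : 0 < cf_rest x k -> 1 <= cf_digit x k.+1.
Proof.
move=> r0; rewrite /= floor_ge_int mulr1z -[1]invr1 lef_pV2 ?posrE//.
by have /andP[_ /ltW] := cf_rest_itv x k.
Qed.

(* The errors of the convergents of x0 at a variable point x: affine in x, with
   the sign that makes them positive at x = x0. *)
Definition signed_err (x0 : R) k x : R :=
  (-1) ^+ k * ((cf_num x0 k)%:~R - (cf_den x0 k)%:~R * x).

Lemma signed_err0 x0 x : signed_err x0 0 x = 1.
Proof. by rewrite /signed_err expr0 mul0r subr0 mul1r. Qed.

Lemma signed_err1 x0 x : signed_err x0 1 x = x - (Num.floor x0)%:~R.
Proof. by rewrite /signed_err expr1/= mul1r mulN1r opprB. Qed.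

Lemma signed_errSS x0 k x : signed_err x0 k.+2 x =
  signed_err x0 k x - (cf_digit x0 k.+1)%:~R * signed_err x0 k.+1 x.
Proof. by rewrite /signed_err/= !intrD !intrM !exprS; ring. Qed.

Lemma signed_errB x0 k x y : signed_err x0 k x - signed_err x0 k y =
  (-1) ^+ k * (cf_den x0 k)%:~R * (y - x).
Proof. by rewrite /signed_err; ring. Qed.

(** The determinant identity of consecutive convergents in affine form: the dependence on [x]
    cancels, and the recurrence preserves the combination. *)
Lemma signed_err_bezout x0 k x :
  (cf_den x0 k.+1)%:~R * signed_err x0 k x +
  (cf_den x0 k)%:~R * signed_err x0 k.+1 x = 1.
Proof.
elim: k => [|k IH]; first by rewrite signed_err0 /= mul0r addr0 mul1r.
by rewrite -[RHS]IH signed_errSS /= !intrD !intrM; ring.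
Qed.

(** Two indices at once because the recurrence has order two. The last factor of the second product
    may vanish, which is how a rational point is later identified with its last convergent. *)
Lemma signed_err_self_pair x m : cf_good x m ->
  signed_err x m x = \prod_(j < m) cf_rest x j /\
  signed_err x m.+1 x = \prod_(j < m.+1) cf_rest x j.
Proof.
elim: m => [_|m IH g].
  by rewrite signed_err0 signed_err1 big_ord0 big_ord_recl big_ord0 mulr1.
have [//|E1 E2] := IH; first exact: cf_good_sub g.
split=> //; rewrite signed_errSS E1 E2.
rewrite [in RHS]big_ord_recr big_ord_recr/=.
have r0 : cf_rest x m != 0 by rewrite gt_eqF// g.
by rewrite -!/(cf_rest x m) /fracpart; field.
Qed.

Lemma signed_err_self x n : cf_good x n ->
  signed_err x n x = \prod_(j < n) cf_rest x j.
Proof. by move=> /signed_err_self_pair[]. Qed.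

Lemma cf_err_signed x n : cf_good x n -> cf_err x n = signed_err x n x.
Proof.
move=> g; rewrite -[RHS]ger0_norm; last first.
  rewrite signed_err_self// prodr_ge0// => j _.
  by have /andP[] := cf_rest_itv x j.
by rewrite /signed_err normrM normrX normrN1 expr1n mul1r.
Qed.

Lemma cf_errE x n : cf_good x n -> cf_err x n = \prod_(j < n) cf_rest x j.
Proof. by move=> g; rewrite cf_err_signed// signed_err_self. Qed.

Lemma cf_errS x n : cf_good x n.+1 -> cf_err x n.+1 = cf_err x n * cf_rest x n.
Proof.
move=> g; rewrite cf_errE// cf_errE ?big_ord_recr//; exact: cf_good_sub g.
Qed.

Lemma cf_err0 x : cf_err x 0 = 1.
Proof. by rewrite cf_errE ?big_ord0. Qed.

Lemma cf_err_gt0 x n : cf_good x n -> 0 < cf_err x n.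
Proof. by move=> g; rewrite cf_errE// prodr_gt0// => j _; apply: g. Qed.

Lemma cf_err_ge0 x n : 0 <= cf_err x n.
Proof. exact: normr_ge0. Qed.

Lemma cf_err_lt x n : cf_good x n.+1 -> cf_err x n.+1 < cf_err x n.
Proof.
move=> g; rewrite cf_errS// gtr_pMr; first by have /andP[] := cf_rest_itv x n.
by apply: cf_err_gt0; apply: cf_good_sub g.
Qed.

Lemma cf_err_rec x k : cf_good x k.+2 ->
  cf_err x k = (cf_digit x k.+1)%:~R * cf_err x k.+1 + cf_err x k.+2.
Proof.
move=> g; rewrite !cf_err_signed; try (apply: cf_good_sub g; lia).
by rewrite signed_errSS; ring.
Qed.

(** The digit is at least 1, so e_k is at least the sum of the next two errors. This is the source
    of the geometric decay used below. *)
Lemma cf_errSS_half x k : cf_good x k.+2 -> cf_err x k.+2 *+ 2 <= cf_err x k.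
Proof.
move=> g; rewrite (cf_err_rec _ _ g) mulr2n lerD2r.
have := ltW (cf_err_lt _ _ g) => /le_trans; apply.
rewrite ler_peMl ?cf_err_ge0// ler1z; apply: cf_digit_ge1; exact: g.
Qed.

Lemma cf_den_ge0_le x k : cf_good x k -> 0 <= cf_den x k /\ cf_den x k <= cf_den x k.+1 /\ 1 <= cf_den x k.+1.
Proof.
elim: k => [|k IH g]; first by [].
have [|d0 [d01 d1]] := IH; first exact: cf_good_sub g.
have a1 : 1 <= cf_digit x k.+1 by apply: cf_digit_ge1; exact: g.
have -> : cf_den x k.+2 = cf_digit x k.+1 * cf_den x k.+1 + cf_den x k by [].
by move: a1 d0 d01 d1; set a := cf_digit _ _; set u := cf_den _ _; set v := cf_den _ _; nia.
Qed.

Lemma cf_den_ge0 x k : cf_good x k -> 0 <= (cf_den x k)%:~R :> R.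
Proof. by move=> /cf_den_ge0_le[? _]; rewrite ler0z. Qed.

Lemma cf_denS_ge1 x k : cf_good x k -> 1 <= (cf_den x k.+1)%:~R :> R.
Proof. by move=> /cf_den_ge0_le[_ [_ ?]]; rewrite ler1z. Qed.

Lemma cf_den_le x k : cf_good x k -> (cf_den x k)%:~R <= (cf_den x k.+1)%:~R :> R.
Proof. by move=> /cf_den_ge0_le[_ [? _]]; rewrite ler_int. Qed.

Lemma cf_denSS x k : cf_good x k.+1 ->
  (cf_den x k.+1)%:~R + (cf_den x k)%:~R <= (cf_den x k.+2)%:~R :> R.
Proof.
move=> g; have /cf_den_ge0_le[d0 [d01 d1]] : cf_good x k by exact: cf_good_sub g.
have a1 : 1 <= cf_digit x k.+1 by apply: cf_digit_ge1; exact: g.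
rewrite -intrD ler_int.
have -> : cf_den x k.+2 = cf_digit x k.+1 * cf_den x k.+1 + cf_den x k by [].
by rewrite lerD2r ler_peMl//; lia.
Qed.

Lemma cf_denSS2 x k : cf_good x k.+1 ->
  (cf_den x k)%:~R *+ 2 <= (cf_den x k.+2)%:~R :> R.
Proof.
move=> g; have := cf_denSS _ _ g; apply: le_trans.
rewrite mulr2n lerD2r; apply: cf_den_le; exact: cf_good_sub g.
Qed.

Lemma cf_bezout x k : cf_good x k.+1 ->
  (cf_den x k.+1)%:~R * cf_err x k + (cf_den x k)%:~R * cf_err x k.+1 = 1.
Proof.
move=> g; rewrite !cf_err_signed ?signed_err_bezout//; exact: cf_good_sub g.
Qed.

Lemma cf_den_err_le1 x k : cf_good x k.+1 -> (cf_den x k.+1)%:~R * cf_err x k <= 1.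
Proof.
move=> g; rewrite -[leRHS](cf_bezout _ _ g) lerDl mulr_ge0 ?cf_err_ge0//.
by apply: cf_den_ge0; exact: cf_good_sub g.
Qed.

(** Of the two summands in [cf_bezout], whose sum is 1, the first is the larger. *)
Lemma cf_den_err_ge x k : cf_good x k.+1 -> 1 <= (cf_den x k.+1)%:~R * cf_err x k *+ 2.
Proof.
move=> g; rewrite -[leLHS](cf_bezout _ _ g) mulr2n lerD2l ler_pM//.
- by apply: cf_den_ge0; exact: cf_good_sub g.
- exact: cf_err_ge0.
- by apply: cf_den_le; exact: cf_good_sub g.
- exact/ltW/cf_err_lt.
Qed.

(** * Cylinders: points sharing their first digits *)

Lemma signed_err_chain x0 m x : cf_good x0 m ->
  0 < signed_err x0 m.+1 x < signed_err x0 m x ->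
  forall k, (k <= m)%N -> 0 < signed_err x0 k.+1 x < signed_err x0 k x.
Proof.
elim: m => [_ H k|m IH g H k]; first by rewrite leqn0 => /eqP->.
rewrite leq_eqVlt => /predU1P[->//|]; rewrite ltnS => km.
apply: IH km; first exact: cf_good_sub g.
move: H; rewrite signed_errSS.
have : 1 <= (cf_digit x0 m.+1)%:~R :> R by rewrite ler1z cf_digit_ge1// g.
set a := (cf_digit x0 m.+1)%:~R; set u := signed_err _ _ _; set v := signed_err _ _ _.
move=> a1 /andP[]; rewrite subr_gt0 => ? ?; nra.
Qed.

(** The two inequalities cut out the interior of the cylinder of [x0]. Run backwards, the recurrence
    keeps the errors positive and decreasing, so their successive quotients at [x] lie in (0,1) and
    obey the Gauss map with the digits of [x0]. *)
Lemma cylinder_digits x0 m x : cf_good x0 m ->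
  0 < signed_err x0 m.+1 x < signed_err x0 m x ->
  forall k, (k <= m)%N -> cf_digit x k = cf_digit x0 k /\
    cf_rest x k = signed_err x0 k.+1 x / signed_err x0 k x.
Proof.
move=> g H; have C := signed_err_chain _ _ _ g H.
elim => [_|k IH km].
  have := C 0%N isT; rewrite signed_err1 signed_err0 divr1 => /andP[a b].
  have E : Num.floor x = Num.floor x0.
    by apply: floor_def; rewrite intrD -subr_ge0 ltW//= addrC -ltrBlDr.
  by split => //; rewrite /cf_rest /fracpart /= E.
have [_ Ek] := IH (ltnW km).
have /andP[k1 k2] := C k (ltnW km); have /andP[k3 k4] := C k.+1 km.
have E1 : (cf_rest x k)^-1 = (cf_digit x0 k.+1)%:~R + signed_err x0 k.+2 x / signed_err x0 k.+1 x.
  rewrite Ek invf_div signed_errSS; field; exact/lt0r_neq0.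
have E2 : cf_digit x k.+1 = cf_digit x0 k.+1.
  rewrite {1}/cf_digit E1; apply: floor_def; rewrite intrD lerDl ltrD2l mulr1z.
  by rewrite divr_ge0 ?ltW//= ltr_pdivrMr// mul1r.
split=> //; have -> : cf_rest x k.+1 = (cf_rest x k)^-1 - (cf_digit x k.+1)%:~R by [].
by rewrite E1 E2 [X in X - _]addrC addrK.
Qed.

Lemma digits_num_den x y m : (forall k, (k <= m)%N -> cf_digit x k = cf_digit y k) ->
  forall k, (k <= m.+1)%N -> cf_num x k = cf_num y k /\ cf_den x k = cf_den y k.
Proof.
move=> E k km; suff : (k <= m.+1)%N -> (cf_num x k = cf_num y k /\ cf_den x k = cf_den y k) /\
  ((k < m.+1)%N -> cf_num x k.+1 = cf_num y k.+1 /\ cf_den x k.+1 = cf_den y k.+1).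
  by case.
elim: k {km} => [|k IH] km; first by split => // _; rewrite -!/(cf_digit _ 0) /cf_num E.
have [[a b] c] := IH (ltnW km); have [d e] := c km.
split=> // km1.
have -> : cf_num x k.+2 = cf_digit x k.+1 * cf_num x k.+1 + cf_num x k by [].
have -> : cf_den x k.+2 = cf_digit x k.+1 * cf_den x k.+1 + cf_den x k by [].
by rewrite a b d e E.
Qed.

Lemma cylinder_num_den x0 m x : cf_good x0 m ->
  0 < signed_err x0 m.+1 x < signed_err x0 m x ->
  forall k, (k <= m.+1)%N -> cf_num x k = cf_num x0 k /\ cf_den x k = cf_den x0 k.
Proof.
move=> g H; apply: digits_num_den => k km.
by have [] := cylinder_digits _ _ _ g H k km.
Qed.

End continued_fraction_facts.

(** * The terms of the Brjuno series *)

Section brjuno_terms.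
Context {R : realType}.
Implicit Types (x y : R) (k m n : nat).

(** From ln (1 + u) <= u. The sum of inverses replaces the inverse of the smaller number and is
    symmetric in the two points. *)
Lemma ln_lip (a b : R) : 0 < a -> 0 < b ->
  `|ln a - ln b| <= `|a - b| * (a^-1 + b^-1).
Proof.
have H (c d : R) : 0 < c -> 0 < d -> ln c - ln d <= `|c - d| * (c^-1 + d^-1).
  move=> c0 d0; rewrite -ln_div ?posrE//.
  have -> : c / d = 1 + (c - d) / d by field; exact/lt0r_neq0.
  apply: le_trans (le_ln1Dx _) _.
    rewrite -subr_gt0; have -> : (c - d) / d - (-1) = c / d by field; exact/lt0r_neq0.
    exact: divr_gt0.
  apply: (@le_trans _ _ (`|c - d| / d)).
    by rewrite ler_pM2r ?invr_gt0// ler_norm.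
  by rewrite ler_wpM2l// lerDr invr_ge0 ltW.
move=> a0 b0; rewrite ler_norml (H a b)// andbT lerNl opprB.
by have := H b a b0 a0; rewrite distrC [b^-1 + _]addrC.
Qed.

(** Perturbation of one term: [u], [v] are consecutive errors at one point, [u'], [v'] those at
    another, [p] and [q] the denominators bounding how fast they move, [d] the distance. The
    prefactor absorbs the speed because [q * u <= 1]; three pieces of a product rule give the factor
    3. *)
Lemma xln_lip (u v u' v' p q d : R) : 0 < v <= u -> 0 < v' <= u' ->
  0 <= p <= q -> q * u <= 1 -> q * u' <= 1 -> 0 <= d ->
  `|u - u'| <= p * d -> `|v - v'| <= q * d ->
  `|u * ln (u / v) - u' * ln (u' / v')| <= d * (v^-1 + v'^-1) *+ 3.
Proof.
move=> /andP[v0 vu] /andP[v'0 vu'] /andP[p0 pq] qu qu' d0 uu vv.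
have u0 : 0 < u by exact: lt_le_trans vu.
have u'0 : 0 < u' by exact: lt_le_trans vu'.
have -> : u * ln (u / v) - u' * ln (u' / v') = (u - u') * ln (u / v) +
    (u' * (ln u - ln u') + u' * (ln v' - ln v)).
  by rewrite !ln_div ?posrE//; ring.
have iv0 : 0 < v^-1 by rewrite invr_gt0.
have iv'0 : 0 < v'^-1 by rewrite invr_gt0.
have iu : u^-1 <= v^-1 by rewrite lef_pV2.
have iu' : u'^-1 <= v'^-1 by rewrite lef_pV2.
have A : `|(u - u') * ln (u / v)| <= d * (v^-1 + v'^-1).
  rewrite normrM [`|ln _|]ger0_norm; last by rewrite ln_ge0// ler_pdivlMr// mul1r.
  apply: (@le_trans _ _ (p * d * (u / v))).
    by apply: ler_pM => //; [rewrite ln_ge0// ler_pdivlMr// mul1r|apply/ltW/ln_sublinear/divr_gt0].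
  have -> : p * d * (u / v) = (p * u) * (d * v^-1) by ring.
  apply: (@le_trans _ _ (d * v^-1)); last by rewrite ler_wpM2l// lerDl ltW.
  by rewrite ler_piMl ?mulr_ge0 ?(ltW iv0)//; apply: le_trans qu; rewrite ler_pM2r.
have BC (z w r : R) : 0 < z -> 0 < w -> u' * r <= 1 -> 0 <= r ->
    z^-1 <= v^-1 -> w^-1 <= v'^-1 ->
    `|z - w| <= r * d -> `|ln z - ln w| * u' <= d * (v^-1 + v'^-1).
  move=> z0 w0 ur r0 zv wv' zw; rewrite mulrC.
  apply: (@le_trans _ _ (u' * (r * d * (v^-1 + v'^-1)))).
    rewrite ler_pM2l//; apply: le_trans (ln_lip _ _ z0 w0) _.
    by apply: ler_pM => //; [rewrite addr_ge0// invr_ge0 ltW|exact: lerD].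
  rewrite !mulrA -mulrA ler_piMl//.
  by rewrite mulr_ge0// addr_ge0 ?(ltW iv0)// ltW.
have B : `|u' * (ln u - ln u')| <= d * (v^-1 + v'^-1).
  rewrite normrM mulrC (gtr0_norm u'0); apply: (BC _ _ p) => //.
  by apply: le_trans qu'; rewrite mulrC ler_pM2r.
have C : `|u' * (ln v' - ln v)| <= d * (v^-1 + v'^-1).
  rewrite normrM mulrC (gtr0_norm u'0) distrC; apply: (BC _ _ q) => //.
    by rewrite mulrC.
  exact: le_trans pq.
apply: le_trans (ler_normD _ _) _; rewrite mulrS lerD//.
by apply: le_trans (ler_normD _ _) _; rewrite mulr2n lerD.
Qed.

(** Along each parity the sequence at least doubles, so its sum is at most twice its last term; the
    two parities give 4. *)
Lemma sum_doubling (s : nat -> R) m : (forall j, 0 <= s j) ->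
  (forall j, s j <= s j.+1) -> (forall j, s j *+ 2 <= s j.+2) ->
  \sum_(j < m) s j.+1 <= s m *+ 4.
Proof.
move=> s0 s1 s2; case: m => [|m]; first by rewrite big_ord0 mulrn_wge0.
suff H : \sum_(j < m.+1) s j.+1 <= s m.+1 *+ 2 + s m *+ 2.
  by apply: le_trans H _; rewrite -[4%N]/(2 + 2)%N mulrnDr lerD2l lerMn2r s1 orbT.
elim: m => [|m IH].
  by rewrite big_ord1; have := s0 0%N; have := s0 1%N; lra.
by rewrite big_ord_recr /=; have := s2 m; have := s0 m; lra.
Qed.

Definition brjuno_term x j : R := cf_err x j * ln (cf_err x j / cf_err x j.+1).
Definition brjuno_sum x m : R := \sum_(j < m) brjuno_term x j.
Definition brjuno_tail x m : \bar R := (\sum_(m <= j <oo) (brjuno_term x j)%:E)%E.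

Lemma irrational_err_gt0 x k : irrational x -> 0 < cf_err x k.
Proof. by move=> ix; apply: cf_err_gt0; exact: irrational_good. Qed.
Lemma irrational_err_lt x k : irrational x -> cf_err x k.+1 < cf_err x k.
Proof. by move=> ix; apply: cf_err_lt; exact: irrational_good. Qed.

Lemma brjuno_term_ge0 x j : irrational x -> 0 <= brjuno_term x j.
Proof.
move=> ix; rewrite mulr_ge0 ?cf_err_ge0// ln_ge0// ler_pdivlMr ?irrational_err_gt0//.
by rewrite mul1r ltW// irrational_err_lt.
Qed.

Lemma cf_err_fracpart x k : irrational x -> cf_err (fracpart x) k = cf_err x k.
Proof.
move=> ix; rewrite !cf_errE; try exact: irrational_good.
  by apply: eq_bigr => j _; rewrite cf_rest_fracpart.
exact/irrational_good/irrational_fracpart.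
Qed.

Lemma brjunoE x m : irrational x -> brjuno x = ((brjuno_sum x m)%:E + brjuno_tail x m)%E.
Proof.
move=> ix; rewrite /brjuno mem_set//.
transitivity (\sum_(0 <= j <oo) (brjuno_term x j)%:E)%E.
  by apply: eq_eseriesr => j _; rewrite !cf_err_fracpart.
rewrite (nneseries_split 0 m) ?add0n; last by move=> k _; rewrite lee_fin brjuno_term_ge0.
by rewrite big_mkord /brjuno_sum sumEFin.
Qed.

Lemma brjuno_tail_ge0 x m : irrational x -> (0 <= brjuno_tail x m)%E.
Proof. by move=> ix; apply: nneseries_ge0 => j _ _; rewrite lee_fin brjuno_term_ge0. Qed.

Lemma brjuno_ge0 x : (0 <= brjuno x)%E.
Proof.
have [ix|nix] := pselect (irrational x); last by rewrite /brjuno memNset.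
rewrite (brjunoE x 0)// adde_ge0 ?brjuno_tail_ge0// lee_fin.
by apply: sumr_ge0 => j _; exact: brjuno_term_ge0.
Qed.

Lemma cf_errB x y k : irrational x -> irrational y ->
  cf_num x k = cf_num y k -> cf_den x k = cf_den y k ->
  `|cf_err x k - cf_err y k| = (cf_den x k)%:~R * `|x - y|.
Proof.
move=> ix iy En Ed.
have gx := irrational_good x k ix; have gy := irrational_good y k iy.
have -> : cf_err x k = signed_err y k x.
  by rewrite (cf_err_signed _ _ gx) /signed_err En Ed.
rewrite (cf_err_signed _ _ gy) signed_errB -Ed !normrM normrX normrN1 expr1n mul1r distrC.
by rewrite (ger0_norm (cf_den_ge0 _ _ gx)).
Qed.

(** The perturbation of a term is proportional to the inverse errors, which double every two steps,
    so the last ones dominate: 12 is 3 for a term times 4 for the sum. *)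
Lemma brjuno_sum_lip x y m : irrational x -> irrational y ->
  (forall k, (k <= m)%N -> cf_num x k = cf_num y k /\ cf_den x k = cf_den y k) ->
  `|brjuno_sum x m - brjuno_sum y m| <=
    `|x - y| * ((cf_err x m)^-1 + (cf_err y m)^-1) *+ 12.
Proof.
move=> ix iy E; rewrite /brjuno_sum -sumrB.
pose s k := (cf_err x k)^-1 + (cf_err y k)^-1.
apply: (@le_trans _ _ (\sum_(j < m) `|x - y| * s j.+1 *+ 3)).
  apply: le_trans (ler_norm_sum _ _ _) _; apply: ler_sum => -[j jm] _ /=.
  have [En Ed] := E j (ltnW jm); have [En1 Ed1] := E j.+1 jm.
  apply: (@xln_lip _ _ _ _ (cf_den x j)%:~R (cf_den x j.+1)%:~R).
  - by rewrite irrational_err_gt0// ltW// irrational_err_lt.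
  - by rewrite irrational_err_gt0// ltW// irrational_err_lt.
  - by rewrite cf_den_ge0 ?cf_den_le//; exact: irrational_good.
  - by apply: cf_den_err_le1; exact: irrational_good.
  - by rewrite Ed1; apply: cf_den_err_le1; exact: irrational_good.
  - by [].
  - by rewrite cf_errB.
  - by rewrite cf_errB.
have -> : \sum_(j < m) `|x - y| * s j.+1 *+ 3 = (`|x - y| * \sum_(j < m) s j.+1) *+ 3.
  by rewrite mulr_sumr sumrMnl.
rewrite -[12%N]/(4 * 3)%N mulrnA lerMn2r/= -mulrnAr ler_wpM2l//.
have sV (a b : R) : 0 < a -> a *+ 2 <= b -> b^-1 *+ 2 <= a^-1.
  move=> a0 ab; have b0 : 0 < b by lra.
  rewrite -mulr_natl ler_pdivrMr// mulrC ler_pdivlMr//; lra.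
apply: sum_doubling => j.
- by rewrite addr_ge0// invr_ge0 cf_err_ge0.
- by rewrite lerD// lef_pV2 ?posrE ?irrational_err_gt0// ltW// irrational_err_lt.
- by rewrite mulrnDl lerD// sV ?irrational_err_gt0// cf_errSS_half//; exact: irrational_good.
Qed.

(** e_j is at most 1/q_j, both as the factor and inside the logarithm. *)
Lemma brjuno_term_le x j : irrational x ->
  brjuno_term x j <= (cf_den x j.+1)%:~R^-1 *
    ln ((cf_den x j.+1)%:~R * cf_err x j.+1)^-1.
Proof.
move=> ix; have g k := irrational_good x k ix.
have e0 k : 0 < cf_err x k by exact: irrational_err_gt0.
have q1 := cf_denS_ge1 _ _ (g j); set q : R := _%:~R in q1 *.
have q0 : 0 < q by exact: lt_le_trans q1.
have eq1 : cf_err x j <= q^-1.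
  by rewrite -div1r ler_pdivlMr// mulrC cf_den_err_le1.
apply: ler_pM; rewrite ?cf_err_ge0//.
  by rewrite ln_ge0// ler_pdivlMr// mul1r ltW// irrational_err_lt.
rewrite ler_ln ?posrE ?invr_gt0 ?mulr_gt0 ?invr_gt0//.
by rewrite invfM ler_pM2r// invr_gt0.
Qed.

Lemma cf_err_dist x j : irrational x ->
  `|x - (cf_num x j.+1)%:~R / (cf_den x j.+1)%:~R| = cf_err x j.+1 / (cf_den x j.+1)%:~R.
Proof.
move=> ix; have q1 := cf_denS_ge1 _ _ (irrational_good x j ix).
rewrite /cf_err; set q : R := (cf_den _ _)%:~R in q1 *; set p : R := (cf_num _ _)%:~R.
have q0 : 0 < q by exact: lt_le_trans q1.
have -> : x - p / q = (q * x - p) / q by field; exact/lt0r_neq0.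
by rewrite normrM distrC normfV (gtr0_norm q0).
Qed.

(** Any lower bound [D] of the denominator is allowed, so that a whole dyadic block shares one bound
    depending only on the distance to the fraction. The logarithm stays nonnegative because q_j
    e_(j+1) <= 1. *)
Lemma brjuno_term_le_dist x j (D : R) : irrational x -> 0 < D ->
  D <= (cf_den x j.+1)%:~R ->
  brjuno_term x j <= D^-1 *
    ln (D ^+ 2 * `|x - (cf_num x j.+1)%:~R / (cf_den x j.+1)%:~R|)^-1.
Proof.
move=> ix D0 Dq; rewrite cf_err_dist//.
apply: le_trans (brjuno_term_le _ j ix) _.
have g k := irrational_good x k ix.
set q : R := (cf_den _ _)%:~R in Dq *.
have q0 : 0 < q by exact: lt_le_trans Dq.
have e0 : 0 < cf_err x j.+1 by exact: irrational_err_gt0.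
have qe : q * cf_err x j.+1 <= 1.
  apply: le_trans (cf_den_err_le1 _ _ (g j.+1)); rewrite ler_pM2l//.
  by rewrite ltW// irrational_err_lt.
apply: ler_pM; rewrite ?invr_ge0 ?(ltW q0)//.
- by rewrite ln_ge0// invf_ge1// mulr_gt0.
- by rewrite lef_pV2.
- rewrite ler_ln ?posrE ?invr_gt0 ?mulr_gt0 ?invr_gt0 ?exprn_gt0//.
  rewrite lef_pV2 ?posrE ?mulr_gt0 ?invr_gt0 ?exprn_gt0//.
  rewrite mulrCA mulrC ler_pM2r// ler_pdivrMr// -expr2.
  by rewrite ler_sqr// nnegrE ltW.
Qed.

End brjuno_terms.

(** * Averages of the tail of the series *)

Section denominator_blocks.
Context {R : realType}.
Implicit Types (a b x v w D Q : R) (i j k m n K : nat).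
Local Notation mu := (@lebesgue_measure R).

Lemma nneseries_le (f : nat -> \bar R) N (M : \bar R) :
  (forall n, (0 <= f n)%E) -> (forall n, (\sum_(N <= k < n) f k <= M)%E) ->
  (\sum_(N <= k <oo) f k <= M)%E.
Proof.
move=> f0 fM; apply: lime_le; first by apply: is_cvg_nneseries => *.
exact: nearW.
Qed.

Lemma nneseries_geo_le (f : nat -> \bar R) (c : R) : 0 <= c ->
  (forall n, (0 <= f n <= (c / 2 ^+ n)%:E)%E) ->
  (\sum_(0 <= k <oo) f k <= (c *+ 2)%:E)%E.
Proof.
move=> c0 fc; apply: nneseries_le => n; first by have /andP[] := fc n.
apply: (@le_trans _ _ (\sum_(0 <= k < n) (c / 2 ^+ k)%:E)%E).
  by apply: lee_sum => k _; have /andP[] := fc k.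
rewrite sumEFin lee_fin.
suff -> : \sum_(0 <= k < n) c / 2 ^+ k = c *+ 2 - c *+ 2 / 2 ^+ n.
  by rewrite lerBlDr lerDl divr_ge0// ?mulrn_wge0// exprn_ge0.
elim: n => [|n IH]; first by rewrite big_geq// expr0 divr1 subrr.
rewrite big_nat_recr//= IH exprS; field.
by rewrite expf_neq0.
Qed.

Lemma ln_le_nat (y : R) n : 0 < y -> y <= 2 ^+ n -> ln y <= n%:R.
Proof.
move=> y0 yn; apply: (@le_trans _ _ (ln (2 ^+ n))).
  by rewrite ler_ln ?posrE// exprn_gt0.
rewrite lnXn// -[leLHS]mulr_natr ler_piMl//.
have := @le_ln1Dx R 1; have -> : (1 + 1 : R) = 2 by []. by apply; lra.
Qed.

(** * Fractions with denominators in a dyadic block *)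

Definition fractions_in_block D : set R :=
  [set v | exists p q : int, [/\ D <= q%:~R, q%:~R < 2 * D & v = p%:~R / q%:~R]].

(** Two distinct fractions differ by at least 1/(q q'), and both denominators are below [2 * D]. *)
Lemma fractions_separated D v w : 0 < D -> fractions_in_block D v ->
  fractions_in_block D w -> `|v - w| * (4 * D ^+ 2) < 1 -> v = w.
Proof.
move=> D0 [p [q [Dq qD ->]]] [p' [q' [Dq' q'D ->]]] vw.
have q0 : 0 < q%:~R :> R by exact: lt_le_trans Dq.
have q'0 : 0 < q'%:~R :> R by exact: lt_le_trans Dq'.
apply/eqP; rewrite -subr_eq0; apply/negPn/negP => n0.
have E : p%:~R / q%:~R - p'%:~R / q'%:~R =
    (p * q' - p' * q)%:~R / (q%:~R * q'%:~R) :> R.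
  by rewrite intrB !intrM; field; rewrite !lt0r_neq0.
move: vw n0; rewrite E normrM normfV [`|_ * _|]gtr0_norm ?mulr_gt0//.
rewrite mulf_eq0 invr_eq0 [_ * _ == 0]gt_eqF ?mulr_gt0// orbF intr_eq0.
set z := p * q' - _ => h z0.
have z1 : 1 <= `|z%:~R| :> R by rewrite -intr_norm ler1z -gtz0_ge1 normr_gt0.
move: h; apply/negP; rewrite -leNgt mulrAC ler_pdivlMr ?mulr_gt0// mul1r.
apply: (@le_trans _ _ (4 * D ^+ 2)); last by rewrite ler_peMl// mulr_ge0// exprn_ge0// ltW.
have -> : 4 * D ^+ 2 = (2 * D) * (2 * D) by ring.
by apply: ler_pM; rewrite ltW.
Qed.

(** Grid of mesh 1/(4 D^2), so that a cell contains at most one fraction of the block. It starts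
    D^-2 before [a] because a convergent of a point of [a, b] may lie that far outside. *)
Definition cell a D v : nat := Num.trunc ((v - (a - D ^- 2)) * (4 * D ^+ 2)).

(** The only fraction of the block in the cell; an empty cell gets the default 0, which merely adds
    nonnegative bumps to the majorant. *)
Definition cell_fraction a D n : R :=
  xget 0 [set v | fractions_in_block D v /\ a - D ^- 2 <= v /\ cell a D v = n].

Lemma cell_fractionE a D v : 0 < D -> fractions_in_block D v -> a - D ^- 2 <= v ->
  cell_fraction a D (cell a D v) = v.
Proof.
move=> D0 fv av; rewrite /cell_fraction; set P := (P in xget _ P).
have [fw [aw cw]] : P (xget 0 P) by apply: xgetPex; exists v.
set w := xget 0 P in fw aw cw *; apply: (fractions_separated D) => //.
have c0 : 0 < 4 * D ^+ 2 by rewrite mulr_gt0// exprn_gt0.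
rewrite -(gtr0_norm c0) -normrM.
have tv := @truncn_itv R ((v - (a - D ^- 2)) * (4 * D ^+ 2)).
have tw := @truncn_itv R ((w - (a - D ^- 2)) * (4 * D ^+ 2)).
have v0 : 0 <= v - (a - D ^- 2) by rewrite subr_ge0.
have w0 : 0 <= w - (a - D ^- 2) by rewrite subr_ge0.
have /andP[] := tv (mulr_ge0 v0 (ltW c0)).
have /andP[] := tw (mulr_ge0 w0 (ltW c0)).
rewrite -!/(cell _ _ _) cw => h3 h4 h1 h2.
have nS : (cell a D v).+1%:R = (cell a D v)%:R + 1 :> R by rewrite natr1.
have -> : (w - v) * (4 * D ^+ 2) = (w - (a - D ^- 2)) * (4 * D ^+ 2) - (v - (a - D ^- 2)) * (4 * D ^+ 2) by ring.
by rewrite ltr_norml; apply/andP; split; move: h1 h2 h3 h4; rewrite nS; lra.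
Qed.

(** The 8 is the total margin 2 D^-2 divided by the mesh. *)
Definition ncells (l D : R) : nat := (Num.trunc (l * (4 * D ^+ 2) + 8)).+1.

Lemma ncells_le (l D : R) : 0 <= l -> (ncells l D)%:R <= l * (4 * D ^+ 2) + 9.
Proof.
move=> l0; rewrite /ncells -natr1.
have H : 0 <= l * (4 * D ^+ 2) + 8.
  have D2 : 0 <= D ^+ 2 by exact: sqr_ge0.
  by have := mulr_ge0 l0 D2; lra.
by have /andP[] := truncn_itv H; lra.
Qed.

Lemma cell_lt a b D v : 0 < D -> a - D ^- 2 <= v <= b + D ^- 2 ->
  (cell a D v < ncells (b - a) D)%N.
Proof.
move=> D0 /andP[av vb]; rewrite ltnS; apply: le_truncn.
have c0 : 0 < D ^+ 2 by rewrite exprn_gt0.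
have -> : (b - a) * (4 * D ^+ 2) + 8 = (b + D ^- 2 - (a - D ^- 2)) * (4 * D ^+ 2).
  by field; exact: lt0r_neq0.
by rewrite ler_pM2r ?lerD2r// mulr_gt0.
Qed.

Lemma integral_cst_itv a b (r : R) : a < b ->
  (\int[mu]_(x in `[a, b]) r%:E = (r * (b - a))%:E)%E.
Proof.
move=> ab; rewrite integral_cst// EFinM; congr (_ * _)%E.
have := @lebesgue_measure_itv R `[a, b]; rewrite /= lte_fin ab -EFinD => <-.
by [].
Qed.

Definition bump (r s x : R) : \bar R := (\1_(`[r - s, r + s]%classic) x)%:E.

Lemma bump_ge0 r s x : (0 <= bump r s x)%E.
Proof. by rewrite lee_fin. Qed.

Lemma measurable_bump r s : measurable_fun setT (bump r s).
Proof. by apply/measurable_EFinP; exact: measurable_indic. Qed.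

Lemma integral_bump_le a b r s : 0 <= s ->
  (\int[mu]_(x in `[a, b]) bump r s x <= (s *+ 2)%:E)%E.
Proof.
move=> s0; rewrite integral_indic//.
apply: (@le_trans _ _ (mu (`[r - s, r + s]%classic : set R))).
  by apply: le_measure; rewrite ?inE//; exact: measurableI.
rewrite lebesgue_measure_itv /=; case: ifP => _; last by rewrite lee_fin mulrn_wge0.
by rewrite -EFinD lee_fin; lra.
Qed.

(** A layer-cake majorant of ln (1/(D^2 d)), with d the distance to a fraction of the block: [K],
    plus one indicator for each level 2^-(K+k) that D^2 d has reached. *)
Definition block a b K D x : \bar R :=
  ((K%:R)%:E + \sum_(c < ncells (b - a) D)
    \sum_(0 <= k <oo) bump (cell_fraction a D c) (2 ^- (K + k) / D ^+ 2) x)%E.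

Lemma block_ge0 a b K D x : (0 <= block a b K D x)%E.
Proof.
rewrite adde_ge0 ?lee_fin// sume_ge0// => c _.
by apply: nneseries_ge0 => *; exact: bump_ge0.
Qed.

Lemma measurable_bumps r (s : nat -> R) :
  measurable_fun setT (fun x => \sum_(0 <= k <oo) bump r (s k) x)%E.
Proof.
apply: (@ge0_emeasurable_sum _ _ _ setT (fun k x => bump r (s k) x) xpredT) => *.
  exact: bump_ge0.
exact: measurable_bump.
Qed.

Lemma measurable_block a b K D : measurable_fun setT (block a b K D).
Proof.
apply: emeasurable_funD; first exact: measurable_cst.
by apply: emeasurable_sum => c; exact: measurable_bumps.
Qed.

(** There are at most 4 D^2 (b - a) + 9 cells, each of mass at most 4 2^-K / D^2. The first part
    contributes 16 and, by the condition on [K], the second 36 times the length, whence 52. *)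
Lemma integral_block_le a b K D : 0 < D -> a < b -> 2 ^- K <= D ^+ 2 * (b - a) ->
  (\int[mu]_(x in `[a, b]) block a b K D x <= ((b - a) * (K%:R + 52))%:E)%E.
Proof.
move=> D0 ab HK; have D20 : 0 < D ^+ 2 by rewrite exprn_gt0.
have l0 : 0 < b - a by rewrite subr_gt0.
rewrite ge0_integralD//=; first last.
- apply: measurable_funTS; apply: emeasurable_sum => c; exact: measurable_bumps.
- by move=> x _; apply: sume_ge0 => c _; apply: nneseries_ge0 => *; exact: bump_ge0.
rewrite integral_cst_itv//.
rewrite [in leRHS]mulrDr EFinD; apply: leeD; first by rewrite mulrC.
rewrite ge0_integral_sum//=; first last.
- by move=> c x _; apply: nneseries_ge0 => *; exact: bump_ge0.
- by move=> c; apply: measurable_funTS; exact: measurable_bumps.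
have s0 : 0 <= 2 ^- K / D ^+ 2 :> R by rewrite divr_ge0// ?invr_ge0 exprn_ge0// ltW.
apply: (@le_trans _ _ (\sum_(c < ncells (b - a) D) ((2 ^- K / D ^+ 2) *+ 4)%:E)%E).
  apply: lee_sum => c _; rewrite integral_nneseries//; first last.
  - by move=> *; exact: bump_ge0.
  - by move=> k; apply: measurable_funTS; exact: measurable_bump.
  rewrite -[4%N]/(2 * 2)%N mulrnA; apply: nneseries_geo_le.
    by rewrite mulrn_wge0.
  move=> k; apply/andP; split.
    by apply: integral_ge0 => *; exact: bump_ge0.
  apply: le_trans (integral_bump_le _ _ _ _ _) _.
    by rewrite divr_ge0// ?invr_ge0 exprn_ge0// ltW.
  by rewrite lee_fin exprD invfM mulrAC [leRHS]mulrnAl.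
rewrite sumEFin lee_fin sumr_const card_ord -[leLHS]mulr_natr.
apply: (@le_trans _ _ ((2 ^- K / D ^+ 2) *+ 4 * ((b - a) * (4 * D ^+ 2) + 9))).
  by rewrite ler_wpM2l ?mulrn_wge0// ncells_le// ltW.
have -> : (2 ^- K / D ^+ 2) *+ 4 * ((b - a) * (4 * D ^+ 2) + 9) =
   2 ^- K * ((b - a) * 16) + 2 ^- K / D ^+ 2 * 36.
  by field; rewrite expf_neq0//= lt0r_neq0.
have h1 : 2 ^- K <= 1 :> R by rewrite invf_le1 ?exprn_gt0// exprn_ege1 ?ler1n.
have h2 : 2 ^- K / D ^+ 2 <= b - a by rewrite ler_pdivrMr// mulrC.
have h3 : 2 ^- K * ((b - a) * 16) <= (b - a) * 16 by rewrite ler_piMl// mulr_ge0// ltW.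
lra.
Qed.

Lemma brjuno_term_le_block a b K D x j : irrational x -> 0 < D -> a <= x <= b ->
  D <= (cf_den x j.+1)%:~R < 2 * D ->
  ((brjuno_term x j)%:E <= (D^-1)%:E * block a b K D x)%E.
Proof.
move=> ix D0 /andP[ax xb] /andP[Dq qD].
apply: (@le_trans _ _ (D^-1 * ln (D ^+ 2 * `|x - (cf_num x j.+1)%:~R / (cf_den x j.+1)%:~R|)^-1)%:E).
  by rewrite lee_fin; exact: brjuno_term_le_dist.
rewrite EFinM lee_pmul2l ?fin_numE// ?lte_fin ?invr_gt0//.
have q0 : 0 < (cf_den x j.+1)%:~R :> R by exact: lt_le_trans Dq.
set v : R := (cf_num x j.+1)%:~R / _; set d := `|x - v|.
have d0 : 0 < d by rewrite /d /v cf_err_dist// divr_gt0// irrational_err_gt0.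
have fv : fractions_in_block D v by exists (cf_num x j.+1), (cf_den x j.+1).
have D20 : 0 < D ^+ 2 by rewrite exprn_gt0.
(* A convergent lies within 1/q^2 of the point, so its cell is among those counted. *)
have dD : d <= D ^- 2.
  rewrite /d /v cf_err_dist// ler_pdivrMr//.
  have h := irrational_good x j.+2 ix.
  apply: (@le_trans _ _ (cf_den x j.+1)%:~R^-1).
    rewrite -[_^-1]div1r ler_pdivlMr// mulrC; apply: le_trans (cf_den_err_le1 _ _ h).
    by rewrite ler_wpM2r ?cf_err_ge0// cf_den_le//; apply: cf_good_sub h.
  rewrite (_ : _^-1 = (cf_den x j.+1)%:~R ^- 2 * (cf_den x j.+1)%:~R); last first.
    by field; exact: lt0r_neq0.
  by rewrite ler_pM2r// lef_pV2 ?posrE ?exprn_gt0// ler_sqr// nnegrE ltW.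
have /andP[va vb] : a - D ^- 2 <= v <= b + D ^- 2.
  by move: dD; rewrite /d ler_norml => /andP[? ?]; apply/andP; split; lra.
have cv : (cell a D v < ncells (b - a) D)%N by apply: cell_lt => //; rewrite va.
set y := (_ * _)^-1; have y0 : 0 < y by rewrite invr_gt0 mulr_gt0.
(* For the least such [M] the point lies in the first [M] bumps around [v], and ln 2 <= 1 gives ln y
   <= K + M. *)
have exM : exists M, y <= 2 ^+ (K + M).
  exists (Num.trunc y).+1; apply: (@le_trans _ _ (Num.trunc y).+1%:R).
    by have /andP[_ /ltW] := truncn_itv (ltW y0).
  rewrite -natrX ler_nat; apply: leq_trans (ltnW (ltn_expl _ (ltnSn 1))) _.
  by rewrite leq_exp2l// leq_addl.
have [M yM minM] := ex_minnP exM.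
rewrite /block (bigD1 (Ordinal cv))//= cell_fractionE//.
apply: (@le_trans _ _ ((K%:R)%:E + (\sum_(0 <= k < M) bump v (2 ^- (K + k) / D ^+ 2) x))%E); last first.
  apply: leeD2l; apply: (le_trans _ (leeDl _ _)).
    by apply: nneseries_lim_ge => *; exact: bump_ge0.
  by apply: sume_ge0 => c _; apply: nneseries_ge0 => *; exact: bump_ge0.
have -> : (\sum_(0 <= k < M) bump v (2 ^- (K + k) / D ^+ 2) x)%E = (M%:R)%:E.
  transitivity (\sum_(0 <= k < M) 1%:E : \bar R)%E; last first.
    by rewrite sumEFin big_const_nat subn0 iter_addr_0.
  apply: eq_big_nat => k /andP[_ kM]; rewrite /bump indicE mem_set//=.
  have yk : 2 ^+ (K + k) <= y.
    by rewrite leNgt; apply/negP => /ltW /minM; rewrite leqNgt kM.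
  have dk : d <= 2 ^- (K + k) / D ^+ 2.
    rewrite ler_pdivlMr// mulrC -[leLHS]invrK lef_pV2 ?posrE ?exprn_gt0//.
  by move: dk; rewrite /d ler_norml in_itv/= => /andP[? ?]; apply/andP; split; lra.
by rewrite -EFinD lee_fin -natrD; exact: ln_le_nat.
Qed.

(* The hypothesis on i says that every value is taken at most twice, once along
   each parity. *)
Lemma sum_sparse_le (F : nat -> \bar R) (i : nat -> nat) n :
  (forall k, (0 <= F k)%E) -> (forall j, (i j < i j.+2)%N) ->
  (\sum_(j < n) F (i j) <= 2%:E * \sum_(0 <= k <oo) F k)%E.
Proof.
move=> F0 ii; set S := (\sum_(0 <= k <oo) F k)%E.
have S0 : (0 <= S)%E by apply: nneseries_ge0 => *.
pose p m := (\sum_(0 <= k < m) F k)%E.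
have pS m : (p m <= S)%E by apply: nneseries_lim_ge => *.
have pS1 m k : (k < m)%N -> (F k + p k <= p m)%E.
  move=> km; rewrite addeC -[X in (X <= _)%E]big_nat_recr//= /p.
  rewrite (@big_cat_nat _ _ _ k.+1 0 m)//= leeDl// sume_ge0//.
case: n => [|n]; first by rewrite big_ord0 mule_ge0.
apply: (@le_trans _ _ (\sum_(j < n.+2) F (i j))%E).
  by rewrite [leRHS]big_ord_recr leeDl.
(* One partial sum for each parity: the indices increase strictly along a parity, so a new term
   extends its own partial sum. *)
apply: (@le_trans _ _ (p (i n).+1 + p (i n.+1).+1)%E); last first.
  by rewrite mule_natl mule2n leeD.
elim: n => [|n IH].
  rewrite big_ord_recr big_ord1 /= leeD//.
    by rewrite /p big_nat_recr//= leeDr// sume_ge0.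
  by rewrite /p big_nat_recr//= leeDr// sume_ge0.
rewrite big_ord_recr /=; apply: le_trans (leeD2r _ IH) _.
rewrite addeAC addeC leeD2l//.
apply: le_trans (pS1 _ _ (ltnSn (i n.+2))); rewrite addeC leeD2l//.
have := ii n; set u := (i n); set w := i n.+2 => uw.
by rewrite /p (@big_cat_nat _ _ _ u.+1 0 w)//= leeDl// sume_ge0.
Qed.

(** The tail is split by the blocks from 2^i Q to 2^(i+1) Q. Denominators at least double every two
    steps, so a block is used at most twice, and the weights 1/(2^i Q) sum to 2/Q; hence the 4. [G]
    does not depend on the starting index [m], so one integral controls all tails. *)
Lemma brjuno_tail_dominated (a b Q : R) K : a < b -> 1 <= Q ->
  2 ^- K <= Q ^+ 2 * (b - a) ->
  exists G : R -> \bar R,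
    [/\ measurable_fun setT G, forall x, (0 <= G x)%E,
      forall x m, irrational x -> a <= x <= b -> Q <= (cf_den x m.+1)%:~R ->
        (brjuno_tail x m <= G x)%E &
      (\int[mu]_(x in `[a, b]) G x <= ((b - a) * (K%:R + 52) / Q *+ 4)%:E)%E].
Proof.
move=> ab Q1 HK; have Q0 : 0 < Q by exact: lt_le_trans Q1.
have D0 i : 0 < Q * 2 ^+ i by rewrite mulr_gt0// exprn_gt0.
pose F i x := (((Q * 2 ^+ i)^-1)%:E * block a b K (Q * 2 ^+ i) x)%E.
have F0 i x : (0 <= F i x)%E by rewrite mule_ge0 ?block_ge0// lee_fin invr_ge0 ltW.
have mF i : measurable_fun setT (F i) by apply: measurable_funeM; exact: measurable_block.
have mS : measurable_fun setT (fun x => \sum_(0 <= i <oo) F i x)%E.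
  by apply: (@ge0_emeasurable_sum _ _ _ setT F xpredT).
exists (fun x => 2%:E * \sum_(0 <= i <oo) F i x)%E; split.
- exact: measurable_funeM.
- by move=> x; rewrite mule_ge0// nneseries_ge0.
- move=> x m ix xab Qm.
  apply: nneseries_le => [j|n]; first by rewrite lee_fin brjuno_term_ge0.
  pose q j : R := (cf_den x j.+1)%:~R.
  have g j := irrational_good x j ix.
  have qS j : q j <= q j.+1 by exact: cf_den_le.
  have Qq j : Q <= q (m + j)%N.
    by elim: j => [|j IH]; rewrite ?addn0// addnS; apply: le_trans (qS _).
  pose i j := trunc_log 2 (Num.trunc (q (m + j)%N / Q)).
  have qQ1 j : 1 <= q (m + j)%N / Q by rewrite ler_pdivlMr// mul1r.
  have i1 j : 2 ^+ i j <= q (m + j)%N / Q < 2 ^+ (i j).+1.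
    have t1 : (0 < Num.trunc (q (m + j)%N / Q))%N.
      by rewrite truncn_gt0.
    have /andP[h1 h2] := truncn_itv (le_trans ler01 (qQ1 j)).
    have /andP[h3 h4] := trunc_log_bounds (ltnSn 1) t1.
    apply/andP; split.
      by apply: le_trans h1; rewrite -natrX ler_nat.
    by apply: lt_le_trans h2 _; rewrite -natrX ler_nat.
  have ii j : (i j < i j.+2)%N.
    have /andP[h1 _] := i1 j; have /andP[_ h2] := i1 j.+2.
    have q2 : q (m + j)%N *+ 2 <= q (m + j.+2)%N.
      by rewrite !addnS; exact: cf_denSS2.
    have : 2 ^+ (i j).+1 < 2 ^+ (i j.+2).+1 :> R.
      apply: le_lt_trans h2; rewrite exprS; apply: (@le_trans _ _ (2 * (q (m + j)%N / Q))).
        by rewrite ler_pM2l.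
      by rewrite mulrA ler_pM2r ?invr_gt0// mulr_natl.
    by rewrite ltr_eXn2l ?ltr1n// ltnS.
  apply: le_trans (sum_sparse_le (F ^~ x) i (n - m) _ ii) => //.
  rewrite -{1}[m]add0n big_addn big_mkord; apply: lee_sum => j _.
  rewrite addnC; apply: brjuno_term_le_block => //.
  have /andP[h1 h2] := i1 j; apply/andP; split.
    by rewrite mulrC -ler_pdivlMr.
  by rewrite mulrCA -exprS mulrC -ltr_pdivrMr.
- rewrite ge0_integralZl//; first last.
    by move=> x _; exact: nneseries_ge0.
  + exact: measurable_funTS.
  rewrite integral_nneseries//; last by move=> i; apply: measurable_funTS; exact: mF.
  have c0 : 0 <= (b - a) * (K%:R + 52) / Q.
    by rewrite divr_ge0 ?(ltW Q0)// mulr_ge0 ?(addr_ge0 (ler0n _ _))// subr_ge0 ltW.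
  rewrite (_ : _ *+ 4 = 2 * (((b - a) * (K%:R + 52) / Q) *+ 2)); last by ring.
  rewrite [in leRHS]EFinM lee_pmul2l//.
  apply: nneseries_geo_le => // i; apply/andP; split.
    by apply: integral_ge0.
  rewrite ge0_integralZl//; first last.
  + by rewrite lee_fin invr_ge0 ltW.
  + by move=> x _; exact: block_ge0.
  + by apply: measurable_funTS; exact: measurable_block.
  apply: (@le_trans _ _ (((Q * 2 ^+ i)^-1)%:E * ((b - a) * (K%:R + 52))%:E)%E).
    apply: lee_wpmul2l; first by rewrite lee_fin invr_ge0 ltW.
    apply: integral_block_le => //; apply: le_trans HK _.
    rewrite ler_pM2r ?subr_gt0// ler_sqr ?nnegrE ?(ltW (D0 i)) ?(ltW Q0)//.
    by rewrite ler_peMr ?(ltW Q0)// exprn_ege1// ler1n.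
  by rewrite -EFinM lee_fin invfM mulrC mulrA.
Qed.

End denominator_blocks.

(** * Measurability and local integrability *)

Section brjuno_integrals.
Context {R : realType}.
Implicit Types (a b x y : R) (k m n : nat).
Local Notation mu := (@lebesgue_measure R).

Lemma measurable_rational : measurable (rational : set R).
Proof.
rewrite (_ : rational = \bigcup_q [set ratr q : R]).
  by apply: bigcupT_measurable_rat => q; exact: measurable_set1.
apply/seteqP; split => [x [q _ <-]|x [q _ ->]]; first by exists q.
by exists q.
Qed.

Lemma measurable_fracpart : measurable_fun setT (@fracpart R).
Proof.
apply: measurable_funB; first exact: measurable_id.
apply: nondecreasing_measurable => // x y xy.
by rewrite ler_int; apply: le_floor.
Qed.

(* expR (- ln y) stands for y^-1, with which it agrees only for y > 0. *)
Definition cf_rest_exp x k : R :=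
  iter k (fun y => fracpart (expR (- ln y))) (fracpart x).

Lemma measurable_cf_rest_exp k : measurable_fun setT (cf_rest_exp ^~ k).
Proof.
elim: k => [|k IH]; first exact: measurable_fracpart.
apply: (measurableT_comp measurable_fracpart).
apply: (@measurableT_comp _ _ _ _ _ _ expR) => //.
apply: (@measurableT_comp _ _ _ _ _ _ (@GRing.opp R)) => //.
exact: (@measurableT_comp _ _ _ _ _ _ (@ln R)).
Qed.

Lemma cf_rest_expE x k : irrational x -> cf_rest_exp x k = cf_rest x k.
Proof.
move=> ix; elim: k => [//|k IH].
have g : 0 < cf_rest x k by exact: (irrational_good x k.+1 ix).
rewrite /cf_rest_exp iterS -/(cf_rest_exp x k) IH expRN lnK ?posrE//.
Qed.

Lemma brjuno_termE x k : irrational x ->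
  brjuno_term x k = - (\prod_(j < k) cf_rest x j * ln (cf_rest x k)).
Proof.
move=> ix; rewrite /brjuno_term.
have g j := irrational_good x j ix.
have r0 : 0 < cf_rest x k by exact: (g k.+1).
rewrite cf_errS// invfM mulrA mulfV ?mul1r ?gt_eqF ?irrational_err_gt0//.
by rewrite lnV ?posrE// mulrN cf_errE.
Qed.

Lemma measurable_brjuno : measurable_fun setT (@brjuno R).
Proof.
(* These functions are measurable on the whole line and equal the terms at irrational points; an
   indicator then removes the rational ones. *)
pose T k x : R := - (\prod_(j < k) cf_rest_exp x j * ln (cf_rest_exp x k)).
have mT k : measurable_fun setT (T k).
  apply: measurableT_comp => //; apply: measurable_funM; last first.
    apply: measurableT_comp; [exact: measurable_ln|exact: measurable_cf_rest_exp].
  elim: k => [|k IH].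
    by under eq_fun do rewrite big_ord0; exact: measurable_cst.
  under eq_fun do rewrite big_ord_recr/=.
  apply: measurable_funM => //; exact: measurable_cf_rest_exp.
have TE k x : irrational x -> T k x = brjuno_term x k.
  move=> ix; rewrite brjuno_termE// /T cf_rest_expE//; congr (- (_ * _)).
  by apply: eq_bigr => j _; rewrite cf_rest_expE.
have -> : @brjuno R = fun x => (\sum_(0 <= k <oo) (\1_irrational x * T k x)%:E)%E.
  apply/funext => x; have [ix|nix] := pselect (irrational x).
    rewrite (brjunoE x 0)// /brjuno_sum big_ord0 add0e.
    by apply: eq_eseriesr => k _; rewrite indicE mem_set// mul1r TE.
  rewrite /brjuno memNset//; symmetry; apply: eseries0 => k _ _.
  by rewrite indicE memNset// mul0r.
apply: (@ge0_emeasurable_sum _ _ _ setT (fun k x => (\1_irrational x * T k x)%:E) xpredT).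
  move=> k x _ _; rewrite lee_fin indicE; have [ix|nix] := boolP (x \in irrational).
    by rewrite mul1r TE ?brjuno_term_ge0//; rewrite inE in ix.
  by rewrite mul0r.
move=> k _; apply/measurable_EFinP; apply: measurable_funM => //.
by apply: measurable_indic; apply: measurableC; exact: measurable_rational.
Qed.

Lemma ge0_le_integral_irrational (D : set R) (f g : R -> \bar R) : measurable D ->
  (forall x, (0 <= f x)%E) -> measurable_fun setT f ->
  (forall x, (0 <= g x)%E) -> measurable_fun setT g ->
  (forall x, D x -> irrational x -> (f x <= g x)%E) ->
  (\int[mu]_(x in D) f x <= \int[mu]_(x in D) g x)%E.
Proof.
move=> mD f0 mf g0 mg fg.
have mr := measurable_rational.
have r0 : mu rational = 0%E by exact: lebesgue_measure_rat.
have H (h : R -> \bar R) : measurable_fun setT h -> (forall x, (0 <= h x)%E) ->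
    (\int[mu]_(x in D) h x = \int[mu]_(x in D `\` rational) h x)%E.
  move=> mh h0; apply: ge0_negligible_integral => //; exact: measurable_funTS.
rewrite (H f)// (H g)//; apply: ge0_le_integral => //.
- exact: measurableD.
- exact: measurable_funTS.
- exact: measurable_funTS.
- by move=> x [Dx nx]; exact: fg.
Qed.

Lemma measurable_brjunoB (h : R -> R) : measurable_fun setT h ->
  measurable_fun setT (fun x => `|brjuno x - (h x)%:E|%E).
Proof.
move=> mh; apply: measurableT_comp => //; apply: emeasurable_funB.
  exact: measurable_brjuno.
exact/measurable_EFinP.
Qed.

(** The tail estimate with Q = 1 applies to the whole series, since q_0 = 1. *)
Lemma brjuno_integral_le a b K : a < b -> 2 ^- K <= b - a ->
  (\int[mu]_(x in `[a, b]) brjuno x <= ((b - a) * (K%:R + 52) *+ 4)%:E)%E.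
Proof.
move=> ab HK; have [||G [mG G0 tG iG]] := brjuno_tail_dominated a b 1 K ab.
- by [].
- by rewrite expr1n mul1r.
rewrite divr1 in iG; apply: le_trans iG.
apply: ge0_le_integral_irrational => //.
- exact: brjuno_ge0.
- exact: measurable_brjuno.
move=> x; rewrite /= in_itv/= => xab ix.
by rewrite (brjunoE x 0)// /brjuno_sum big_ord0 add0e tG.
Qed.

Lemma Lp_loc_brjuno : Lp_loc 1 (@brjuno R).
Proof.
split; first exact: measurable_brjuno.
move=> K cK; have mK : measurable K by apply: closed_measurable; exact: compact_closed.
have [M [_ HM]] := compact_bounded cK.
pose N : R := Num.norm (M : R) + 1.
have N1 : 1 <= N by rewrite lerDr.
have KN : K `<=` `[- N, N].
  move=> x Kx; rewrite /= in_itv/= -ler_norml; apply: HM => //.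
  by rewrite (le_lt_trans (ler_norm M))// ltrDl.
under eq_integral do rewrite poweRe1 ?abse_ge0// gee0_abs ?brjuno_ge0//.
have : (\int[mu]_(x in K) brjuno x <= \int[mu]_(x in `[(- N)%R, N]) brjuno x)%E.
  apply: ge0_subset_integral => //.
  - exact: measurable_funTS measurable_brjuno.
  - by move=> x _; exact: brjuno_ge0.
move=> /le_lt_trans; apply; apply: le_lt_trans (@brjuno_integral_le (- N) N 0 _ _) _.
- lra.
- by rewrite expr0 invr1; lra.
- exact: ltry.
Qed.

End brjuno_integrals.

(** * Oscillation near a convergent *)

Section oscillation.
Context {R : realType}.
Implicit Types (a b c r x y : R) (k m n : nat).
Local Notation mu := (@lebesgue_measure R).

Lemma rational_quotient (p q : int) : rational (p%:~R / q%:~R : R).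
Proof.
exists (p%:~R / q%:~R) => //.
transitivity ((ratr p%:~R : R) / ratr q%:~R); first exact: fmorph_div.
by congr (_ / _); exact: ratr_int.
Qed.

Lemma exists_irrational_between a b : a < b -> exists2 x, irrational x & a < x < b.
Proof.
move=> ab; apply: contrapT => nex.
have sub : `]a, b[ `<=` (rational : set R).
  move=> x /=; rewrite in_itv/= => xab; apply: contrapT => ix; apply: nex.
  by exists x.
have : (mu (`]a, b[%classic : set R) <= mu (rational : set R))%E.
  apply: le_measure => //; rewrite inE//; exact: measurable_rational.
have -> : mu (rational : set R) = 0%E by exact: lebesgue_measure_rat.
rewrite lebesgue_measure_itv/= lte_fin ab -EFinB lee_fin; lra.
Qed.

(** No constant is close to both values: (u - c)^+ + (c - v)^+ >= u - v. The excess [G] on the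
    second interval costs at most its integral. *)
Lemma two_value_integral (f : R -> \bar R) (G : R -> \bar R) a b a1 b1 a2 b2 l u v c e :
  measurable_fun setT f -> measurable_fun setT G -> (forall x, (0 <= G x)%E) ->
  0 < l -> b1 - a1 = l -> b2 - a2 = l ->
  a <= a1 -> b1 <= b -> a <= a2 -> b2 <= b -> (b1 < a2) || (b2 < a1) ->
  (forall x, a1 <= x <= b1 -> irrational x -> (u%:E <= f x)%E) ->
  (forall x, a2 <= x <= b2 -> irrational x -> (0 <= f x <= v%:E + G x)%E) ->
  (\int[mu]_(x in `[a2, b2]) G x <= e%:E)%E ->
  ((l * (u - v) - e)%:E <= \int[mu]_(x in `[a, b]) `|f x - c%:E|)%E.
Proof.
move=> mf mG G0 l0 l1 l2 aa1 b1b aa2 b2b disj fu fv Ge.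
have mfc : measurable_fun setT (fun x => `|f x - c%:E|%E).
  by apply: measurableT_comp => //; apply: emeasurable_funB => //; exact: measurable_cst.
have ab1 : a1 < b1 by lra.
have ab2 : a2 < b2 by lra.
set J := (X in (_ <= X)%E).
pose J1 := (\int[mu]_(x in `[a1, b1]) `|f x - c%:E|)%E.
pose J2 := (\int[mu]_(x in `[a2, b2]) `|f x - c%:E|)%E.
have J12 : (J1 + J2 <= J)%E.
  rewrite /J1 /J2 -ge0_integral_setU//=; first last.
  - rewrite disj_set2E; apply/eqP/seteqP; split=> // x /=.
    by rewrite !in_itv/= => -[/andP[h1 h2] /andP[h3 h4]]; move: disj => /orP[]; lra.
  - exact: measurable_funTS.
  apply: ge0_subset_integral => //.
  - exact: measurableU.
  - exact: measurable_funTS.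
  - move=> x /=; rewrite !in_itv/= => -[] /andP[h1 h2]; apply/andP; split; lra.
have h1 : ((l * Num.max 0 (u - c))%:E <= J1)%E.
  rewrite -l1 mulrC -integral_cst_itv//; apply: ge0_le_integral_irrational => //.
  - by move=> x; rewrite lee_fin le_max lexx.
  move=> x; rewrite /= in_itv/= => xab ix; have := fu x xab ix.
  case: (f x) => [z|_|_] /=; [|by rewrite leey|by rewrite leey].
  rewrite !lee_fin => uz; rewrite ge_max normr_ge0/=.
  by apply: le_trans (ler_norm _); rewrite lerD2r.
have h2 : ((l * Num.max 0 (c - v))%:E <= J2 + e%:E)%E.
  apply: le_trans (leeD2l _ Ge).
  rewrite /J2 -ge0_integralD//; first last.
  - exact: measurable_funTS.
  - exact: measurable_funTS.
  rewrite -l2 mulrC -integral_cst_itv//; apply: ge0_le_integral_irrational => //.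
  - by move=> x; rewrite lee_fin le_max lexx.
  - by move=> x; rewrite adde_ge0.
  - exact: emeasurable_funD.
  move=> x; rewrite /= in_itv/= => xab ix; have := fv x xab ix; have := G0 x.
  case: (f x) => [z||]; case: (G x) => [g||]; rewrite /= ?leeNy_eq ?andbF//; try by move=> *; rewrite leey.
  rewrite !lee_fin => g0 /andP[z0 zv]; rewrite ge_max addr_ge0//=.
  by have := ler_norm (c - z); rewrite distrC; lra.
have h3 : ((l * (u - v) - e)%:E + e%:E <= J1 + J2 + e%:E)%E.
  rewrite -EFinD subrK -addeA; apply: le_trans (leeD h1 h2).
  rewrite -EFinD lee_fin -mulrDr ler_pM2l//.
  have := le_max (u - c) 0 (u - c); have := le_max (c - v) 0 (c - v).
  by rewrite !lexx !orbT; lra.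
by apply: le_trans J12; rewrite leeD2rE in h3.
Qed.

(** With [d] = q_(n-1), [q] = q_n and [z] the distance to p_n/q_n, this is e_n: solve the
    determinant identity with e_(n+1) = q z. *)
Definition conj_err (d q z : R) : R := (1 - d * q * z) / q.
(** The term t_n as a function of that distance. *)
Definition log_singularity (d q z : R) : R :=
  conj_err d q z * ln (conj_err d q z / (q * z)).

Lemma conj_err_bounds (d q r z : R) : 1 <= q -> 0 <= d <= q ->
  r * q * q <= 2048^-1 -> 0 <= z <= r ->
  3 / 4 <= conj_err d q z * q /\ conj_err d q z * q <= 1.
Proof.
move=> q1 /andP[d0 dq] rqq /andP[z0 zr].
have q0 : 0 < q by lra.
have h : d * z <= q * r by apply: ler_pM.
have h2 : d * q * z <= 2048^-1.
  by apply: le_trans rqq; rewrite mulrAC [r * q]mulrC ler_pM2r.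
have h3 : 0 <= d * q * z by rewrite !mulr_ge0// ltW.
by rewrite /conj_err divfK ?gt_eqF//; split; lra.
Qed.

Lemma conj_err_gt (d q r z : R) : 1 <= q -> 0 <= d <= q ->
  r * q * q <= 2048^-1 -> 0 <= z <= r ->
  [/\ q * z < conj_err d q z, 0 < conj_err d q z & (conj_err d q z)^-1 <= 2 * q].
Proof.
move=> q1 dq rqq zr; have [] := conj_err_bounds d q r z q1 dq rqq zr.
have q0 : 0 < q by exact: lt_le_trans q1.
set c := conj_err d q z; move: zr => /andP[z0 zr] h1 h2.
have h3 : q * z * q <= 2048^-1.
  by apply: le_trans rqq; rewrite ler_pM2r// mulrC ler_pM2r.
have c0 : 0 < c by rewrite -(pmulr_lgt0 _ q0); clear -h1; lra.
split=> //; first by rewrite -(ltr_pM2r q0); clear -h1 h3; lra.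
by rewrite -div1r ler_pdivrMr// -mulrA [q * _]mulrC; clear -h1; lra.
Qed.

Lemma conj_err_le (d q z w : R) : 1 <= q -> 0 <= d <= q -> z <= w ->
  conj_err d q w <= conj_err d q z.
Proof.
move=> q1 /andP[d0 dq] zw; have q0 : 0 < q by exact: lt_le_trans q1.
by rewrite ler_pM2r ?invr_gt0// lerD2l lerN2 ler_wpM2l// mulr_ge0// ltW.
Qed.

(** Both factors decrease with the distance, and the smallness of [r * q * q] keeps the logarithm
    positive. *)
Lemma log_singularity_le (d q r z w : R) : 1 <= q -> 0 <= d <= q ->
  r * q * q <= 2048^-1 -> 0 < z -> z <= w -> w <= r ->
  log_singularity d q w <= log_singularity d q z.
Proof.
move=> q1 dq rqq z0 zw wr.
have q0 : 0 < q by exact: lt_le_trans q1.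
have w0 : 0 < w by exact: lt_le_trans zw.
have [|h1 h2 _] := conj_err_gt d q r z q1 dq rqq.
  by rewrite (ltW z0) (le_trans zw).
have [|h3 h4 _] := conj_err_gt d q r w q1 dq rqq.
  by rewrite (ltW w0) wr.
have bb := conj_err_le d q z w q1 dq zw.
rewrite /log_singularity; move: h1 h2 h3 h4 bb.
set A := conj_err _ _ z; set B := conj_err _ _ w; move: A B => A B h1 h2 h3 h4 bb.
have qz0 : 0 < q * z by exact: mulr_gt0.
have qw0 : 0 < q * w by exact: mulr_gt0.
have h5 : 1 <= B / (q * w) by rewrite ler_pdivlMr// mul1r ltW.
have h6 : B / (q * w) <= A / (q * z).
  apply: ler_pM => //; [exact: ltW|by rewrite invr_ge0 ltW|].
  by rewrite lef_pV2// ler_pM2l.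
apply: ler_pM => //; [exact: ltW|exact: ln_ge0|].
by rewrite ler_ln// posrE divr_gt0.
Qed.

Lemma ln3_ge : 2 / 3 <= ln (3 : R).
Proof.
have := @le_ln1Dx R (- (2 / 3)); rewrite (_ : 1 + - (2 / 3) = 3^-1); last by field.
by rewrite lnV ?posrE// => h; have := h (_ : _); lra.
Qed.

(** From distance 3r/4 to r/4 the argument of the logarithm grows at least threefold; the factor is
    at least 3/(4q), and ln 3 >= 2/3. *)
Lemma log_singularity_gap (d q r : R) : 1 <= q -> 0 <= d <= q ->
  r * q * q <= 2048^-1 -> 0 < r ->
  q^-1 / 2 <= log_singularity d q (r / 4) - log_singularity d q (3 * r / 4).
Proof.
move=> q1 dq rqq r0; have q0 : 0 < q by exact: lt_le_trans q1.
have i1 : 0 <= r / 4 <= r by apply/andP; split; lra.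
have i2 : 0 <= 3 * r / 4 <= r by apply/andP; split; lra.
have [h1 h2 _] := conj_err_gt d q r _ q1 dq rqq i1.
have [h3 h4 _] := conj_err_gt d q r _ q1 dq rqq i2.
have [h5 _] := conj_err_bounds d q r _ q1 dq rqq i2.
have bb : conj_err d q (3 * r / 4) <= conj_err d q (r / 4) by apply: conj_err_le => //; lra.
rewrite /log_singularity; move: h1 h2 h3 h4 h5 bb.
set A := conj_err _ _ (r / 4); set B := conj_err _ _ _; move: A B => A B h1 h2 h3 h4 h5 bb.
have p1 : 0 < q * (r / 4) by rewrite mulr_gt0// divr_gt0.
have p2 : 0 < q * (3 * r / 4) by rewrite mulr_gt0// divr_gt0// mulr_gt0.
have l0 : 0 <= ln (A / (q * (r / 4))) by rewrite ln_ge0// ler_pdivlMr// mul1r ltW.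
have L : 2 / 3 <= ln (A / (q * (r / 4))) - ln (B / (q * (3 * r / 4))).
  rewrite -ln_div ?posrE ?divr_gt0//.
  have -> : A / (q * (r / 4)) / (B / (q * (3 * r / 4))) = 3 * (A / B).
    by field; rewrite !lt0r_neq0.
  have AB1 : 1 <= A / B by rewrite ler_pdivlMr// mul1r.
  apply: le_trans ln3_ge _; rewrite ler_ln ?posrE//; first by rewrite ler_peMr.
  by rewrite mulr_gt0// divr_gt0.
apply: (@le_trans _ _ (B * (ln (A / (q * (r / 4))) - ln (B / (q * (3 * r / 4)))))); last first.
  by rewrite mulrBr lerD2r ler_wpM2r.
rewrite mulrC ler_pdivrMr// mulrAC.
apply: (@le_trans _ _ (3 / 4 * (2 / 3))); first by clear; lra.
by apply: ler_pM.
Qed.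

(** The quarters of the one-sided interval nearest to and farthest from [v]; [s] selects the
    side. *)
Lemma one_sided_intervals (s v r a b : R) : s = 1 \/ s = -1 -> 0 < r ->
  a <= v - r -> v + r <= b ->
  exists a1 b1 a2 b2,
   [/\ b1 - a1 = r / 4 /\ b2 - a2 = r / 4, (a <= a1 /\ b1 <= b) /\ (a <= a2 /\ b2 <= b),
     (b1 < a2) || (b2 < a1),
     forall x, a1 <= x <= b1 -> 0 <= s * (x - v) <= r / 4 &
     forall x, a2 <= x <= b2 -> 3 * r / 4 <= s * (x - v) <= r].
Proof.
move=> sE r0 av vb.
case: sE => sE; [exists v, (v + r / 4), (v + 3 * r / 4), (v + r)|
                 exists (v - r / 4), v, (v - r), (v - 3 * r / 4)]; split.
- by split; lra.
- by do 2!split; lra.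
- by apply/orP; left; lra.
- by move=> x /andP[? ?]; rewrite sE; apply/andP; split; lra.
- by move=> x /andP[? ?]; rewrite sE; apply/andP; split; lra.
- by split; lra.
- by do 2!split; lra.
- by apply/orP; right; lra.
- by move=> x /andP[? ?]; rewrite sE; apply/andP; split; lra.
- by move=> x /andP[? ?]; rewrite sE; apply/andP; split; lra.
Qed.

(* The coordinate t measures the distance to p_n/q_n on the side of the
   points that share the first digits of x0. *)
Section near_convergent.
Context (x0 : R) (n : nat) (r : R) (g : cf_good x0 n).
Let q : R := (cf_den x0 n.+1)%:~R.
Let d : R := (cf_den x0 n)%:~R.
Let v : R := (cf_num x0 n.+1)%:~R / q.
Context (rqq : r * q * q <= 2048^-1).
Let t x := (-1) ^+ n * (x - v).

Let q1 : 1 <= q. Proof. exact: cf_denS_ge1. Qed.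
Let q0 : 0 < q. Proof. exact: lt_le_trans q1. Qed.
Let dq : 0 <= d <= q. Proof. by rewrite cf_den_ge0//= cf_den_le. Qed.

Lemma signed_errS_coord x : signed_err x0 n.+1 x = q * t x.
Proof.
rewrite /t /v /signed_err exprS -/q; field; exact: lt0r_neq0.
Qed.

Lemma signed_err_coord x : signed_err x0 n x = conj_err d q (t x).
Proof.
have := signed_err_bezout x0 n x; rewrite signed_errS_coord -/q -/d /conj_err => <-.
by field; exact: lt0r_neq0.
Qed.

(** In this coordinate the cylinder condition is 0 < q t < e_n, and its upper half follows from the
    smallness of r q^2. *)
Lemma near_convergent_cylinder x : 0 < t x <= r ->
  forall k, (k <= n.+1)%N -> cf_num x k = cf_num x0 k /\ cf_den x k = cf_den x0 k.
Proof.
move=> /andP[t0 tr]; apply: cylinder_num_den => //.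
rewrite signed_err_coord signed_errS_coord mulr_gt0//=.
by have [|//] := conj_err_gt d q r (t x) q1 dq rqq; rewrite (ltW t0).
Qed.

Lemma near_convergent_err x : irrational x -> 0 < t x <= r ->
  cf_err x n = conj_err d q (t x).
Proof.
move=> ix tx; rewrite (cf_err_signed _ _ (irrational_good x n ix)).
by rewrite -signed_err_coord /signed_err; have [-> ->] := near_convergent_cylinder x tx n (leqnSn n).
Qed.

Lemma near_convergent_errS x : irrational x -> 0 < t x <= r ->
  cf_err x n.+1 = q * t x.
Proof.
move=> ix tx; rewrite (cf_err_signed _ _ (irrational_good x n.+1 ix)).
by rewrite -signed_errS_coord /signed_err; have [-> ->] := near_convergent_cylinder x tx n.+1 (leqnn n.+1).
Qed.

Lemma near_convergent_neq0 x : irrational x -> t x != 0.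
Proof.
move=> ix; rewrite mulf_neq0 ?signr_eq0// subr_eq0; apply/eqP => xv; apply: ix.
by rewrite xv; exact: rational_quotient.
Qed.

Lemma near_convergent_term x : irrational x -> 0 < t x <= r ->
  brjuno_term x n = log_singularity d q (t x).
Proof.
by move=> ix tx; rewrite /brjuno_term near_convergent_err// near_convergent_errS.
Qed.

Lemma near_convergent_sum x y : irrational x -> irrational y ->
  0 < t x <= r -> 0 < t y <= r ->
  `|brjuno_sum x n - brjuno_sum y n| <= 48 * (r * q).
Proof.
move=> ix iy tx ty.
have E k : (k <= n)%N -> cf_num x k = cf_num y k /\ cf_den x k = cf_den y k.
  move=> kn; have [-> ->] := near_convergent_cylinder x tx k (leqW kn).
  by have [-> ->] := near_convergent_cylinder y ty k (leqW kn).
apply: le_trans (brjuno_sum_lip x y n ix iy E) _; rewrite !near_convergent_err//.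
move: tx ty => /andP[tx0 txr] /andP[ty0 tyr].
have [|_ c1 i1] := conj_err_gt d q r (t x) q1 dq rqq; first by rewrite (ltW tx0).
have [|_ c2 i2] := conj_err_gt d q r (t y) q1 dq rqq; first by rewrite (ltW ty0).
have xy : `|x - y| <= r.
  have : `|(-1) ^+ n * (x - y)| <= r.
    have -> : (-1) ^+ n * (x - y) = t x - t y by rewrite /t; ring.
    by rewrite ler_norml; apply/andP; split; lra.
  by rewrite normrM normr_sign mul1r.
(* 48 is 12 times 4, each of the two inverse errors being at most 2q. *)
have -> : 48 * (r * q) = (r * (4 * q)) *+ 12 by ring.
rewrite lerMn2r/=; apply: ler_pM => //; first by rewrite addr_ge0// invr_ge0 ltW.
by lra.
Qed.

End near_convergent.

(* The mean over the quarter of a one-sided interval next to p_n/q_n exceeds the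
   mean over the farthest quarter, because t_n gains (ln 3)/q_n between them. *)
Lemma brjuno_oscillation x0 n r a b c : cf_good x0 n -> 0 < r ->
  r * (cf_den x0 n.+1)%:~R * (cf_den x0 n.+1)%:~R <= 2048^-1 ->
  a <= (cf_num x0 n.+1)%:~R / (cf_den x0 n.+1)%:~R - r ->
  (cf_num x0 n.+1)%:~R / (cf_den x0 n.+1)%:~R + r <= b ->
  ((r / (cf_den x0 n.+1)%:~R / 16)%:E <= \int[mu]_(x in `[a, b]) `|brjuno x - c%:E|)%E.
Proof.
move=> g r0 rqq av vb.
have q1 := cf_denS_ge1 _ _ g; have d0 := cf_den_ge0 _ _ g.
have dq := cf_den_le _ _ g.
have cE := near_convergent_errS x0 n r g rqq.
have cn := near_convergent_neq0 x0 n.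
have ct := near_convergent_term x0 n r g rqq.
have cs := near_convergent_sum x0 n r g rqq.
set q : R := (cf_den x0 n.+1)%:~R in q1 dq rqq av vb cE cn ct cs *.
set v : R := _ / q in av vb cE cn ct cs *.
set d : R := (cf_den x0 n)%:~R in d0 dq ct *.
have sgn : (-1) ^+ n = 1 :> R \/ (-1) ^+ n = -1 :> R.
  by rewrite -signr_odd; case: (odd n); [right|left].
have [a1 [b1 [a2 [b2 [[l1 l2] [[aa1 b1b] [aa2 b2b]] disj]]]]] := one_sided_intervals _ v r a b sgn r0 av vb.
pose t x := (-1) ^+ n * (x - v).
rewrite -/(t _) => tJ1 tJ2.
have q0 : 0 < q by exact: lt_le_trans q1.
have d0q : 0 <= d <= q by rewrite d0.
have tJ1' x : irrational x -> a1 <= x <= b1 -> 0 < t x <= r / 4.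
  by move=> ix /tJ1/andP[h1 ->]; rewrite lt_neqAle eq_sym cn// h1.
have tJ2' x : a2 <= x <= b2 -> 0 < t x <= r.
  by move=> /tJ2/andP[h1 ->]; rewrite (lt_le_trans _ h1)// divr_gt0// mulr_gt0.
have r4 : r / 4 <= r by clear -r0; lra.
have ab2 : a2 < b2 by clear -l2 r0; lra.
(* A reference point: the partial sums on both intervals are compared with the one at [y]. *)
have [y iy /andP[y1 y2]] := exists_irrational_between _ _ ab2.
have ty : 0 < t y <= r by apply: tJ2'; rewrite !ltW.
have split x : irrational x -> 0 < t x <= r -> brjuno x =
    ((brjuno_sum x n + log_singularity d q (t x))%:E + brjuno_tail x n.+1)%E.
  by move=> ix tx; rewrite (brjunoE x n.+1 ix) /brjuno_sum big_ord_recr/= ct.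
(* Lower bound for q_(n+1) on the far interval: 1 <= 2 q_(n+1) e_(n+1), and e_(n+1) <= q r there. *)
pose Q := (2 * (q * r))^-1.
have qr0 : 0 < q * r by rewrite mulr_gt0.
have qr1 : q * r <= 2048^-1.
  by apply: le_trans rqq; rewrite mulrC ler_peMr// mulr_ge0// ltW.
have Q1 : 1 <= Q by rewrite invf_ge1; [|rewrite mulr_gt0//]; clear -qr1; lra.
have Q2 : 2 ^- 0 <= Q ^+ 2 * (b2 - a2).
  rewrite expr0 invr1 l2 /Q exprVn mulrC ler_pdivlMr ?exprn_gt0 ?mulr_gt0// mul1r.
  rewrite (_ : _ ^+ 2 = 4 * (r * q * q) * r); last by ring.
  by rewrite mulrC ler_pM2l//; clear -rqq; lra.
have [G [mG G0 tG iG]] := brjuno_tail_dominated a2 b2 Q 0 ab2 Q1 Q2.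
have iG' : (\int[mu]_(x in `[a2, b2]) G x <= (104 * (r * (r * q)))%:E)%E.
  apply: le_trans iG _; rewrite lee_fin l2 /Q invrK.
  by rewrite le_eqVlt; apply/orP; left; apply/eqP; field.
pose F := log_singularity d q (r / 4); pose F' := log_singularity d q (3 * r / 4).
pose S := brjuno_sum y n; pose k := r * q.
have gap : q^-1 / 2 <= F - F' by exact: log_singularity_gap.
(* After division by [r], a quarter of the gap is at least q^-1/8, and q^-1/16 must remain after the
   errors 24 k + 104 k; this requires 2048 = 16 * 128. *)
have kq : k * 2048 <= q^-1.
  rewrite -div1r ler_pdivlMr; last exact: q0.
  by rewrite mulrAC /k; clear -rqq; lra.
have r40 : 0 < r / 4 by rewrite divr_gt0.
apply: le_trans (two_value_integral brjuno G a b a1 b1 a2 b2 (r / 4)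
  (S - 48 * k + F) (S + 48 * k + F') c _
  measurable_brjuno mG G0 r40 l1 l2 aa1 b1b aa2 b2b disj _ _ iG').
- rewrite lee_fin -/k.
  rewrite (_ : r / 4 * _ - _ = r * ((F - F' - 96 * k) / 4 - 104 * k)); last by field.
  rewrite (_ : r / q / 16 = r * (q^-1 / 16)); last by rewrite mulrA.
  by rewrite ler_pM2l//; clear -gap kq; lra.
- move=> x xab ix; have tx4 := tJ1' x ix xab.
  have tx : 0 < t x <= r by move: tx4 => /andP[-> /le_trans]; apply.
  rewrite split//; apply: (@le_trans _ _ (brjuno_sum x n + log_singularity d q (t x))%:E).
    rewrite lee_fin lerD//.
      by have := cs x y ix iy tx ty; rewrite ler_norml => /andP[h _]; clear -h; rewrite /S /k; lra.
    by move: tx4 => /andP[h1 h2]; apply: log_singularity_le h2 r4.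
  by rewrite leeDl// brjuno_tail_ge0.
- move=> x xab ix; have tx := tJ2' x xab.
  rewrite brjuno_ge0/= split//; apply: leeD.
    rewrite lee_fin lerD//.
      by have := cs x y ix iy tx ty; rewrite ler_norml => /andP[_ h]; clear -h; rewrite /S /k; lra.
    have /andP[h1 h2] := tJ2 x xab.
    by apply: (log_singularity_le d q r) => //; rewrite divr_gt0// mulr_gt0.
  apply: tG => //.
  have g' := irrational_good x n.+2 ix.
  have := cf_den_err_ge _ _ g'; rewrite cE// /Q -/(t x).
  have Q'0 : 0 <= (cf_den x n.+2)%:~R :> R by apply: cf_den_ge0; exact: irrational_good.
  set Q' : R := (cf_den x n.+2)%:~R in Q'0 * => h.
  have tr : q * t x <= q * r by rewrite ler_pM2l//; move: tx => /andP[].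
  rewrite -div1r ler_pdivrMr ?mulr_gt0//.
  apply: le_trans h _; rewrite [leRHS]mulrCA -[leLHS]mulr_natl ler_pM2l//.
  by rewrite ler_wpM2l.
Qed.

End oscillation.

(** * Upper bounds on the exponent *)

Section irregularity.
Context {R : realType}.
Implicit Types (a b c r x y alpha : R) (k m n : nat).
Local Notation mu := (@lebesgue_measure R).

Lemma near_right0P (P : R -> Prop) : (\forall rho \near 0^'+, P rho) <->
  exists2 e : R, 0 < e & forall rho, 0 < rho < e -> P rho.
Proof.
split=> [/nbhs_ballP[e /= e0 H]|[e e0 H]].
  exists e => // rho /andP[r0 re]; apply: H => //.
  by rewrite /ball/= sub0r normrN gtr0_norm.
apply/nbhs_ballP; exists e => //= rho; rewrite /ball/= sub0r normrN => re r0.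
by apply: H; rewrite r0 -(gtr0_norm r0).
Qed.

Lemma poly_bounded_unit (P : {poly R}) :
  exists2 M, 0 <= M & forall h, `|h| <= 1 -> `|P.[h]| <= M.
Proof.
elim/poly_ind: P => [|P c [M M0 H]]; first by exists 0 => // h _; rewrite horner0 normr0.
exists (M + `|c|); first by rewrite addr_ge0.
move=> h h1; rewrite hornerMXaddC; apply: le_trans (ler_normD _ _) _.
by rewrite lerD2r normrM; apply: le_trans (H h h1); rewrite ler_piMr.
Qed.

Lemma poly_lipschitz_unit (P : {poly R}) :
  exists2 M, 0 <= M & forall h, `|h| <= 1 -> `|P.[h] - P.[0]| <= M * `|h|.
Proof.
elim/poly_ind: P => [|P c _].
  by exists 0 => // h _; rewrite !horner0 subrr normr0 mul0r.
have [M M0 H] := poly_bounded_unit P; exists M => // h h1.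
rewrite !hornerMXaddC mulr0 add0r addrK normrM.
by rewrite ler_wpM2r// H.
Qed.

Lemma measurable_poly_shift (P : {poly R}) x : measurable_fun setT (fun y => P.[y - x]).
Proof.
elim/poly_ind: P => [|P c IH].
  by under eq_fun do rewrite horner0; exact: measurable_cst.
under eq_fun do rewrite hornerMXaddC.
apply: measurable_funD => //; apply: measurable_funM => //.
exact: measurable_funB.
Qed.

Lemma mean_brjunoE (h : R -> R) x0 rho (C : R) : 0 < rho ->
  ((((2 * rho)^-1)%:E * \int[mu]_(x in `[(x0 - rho)%R, (x0 + rho)%R])
      (`|brjuno x - (h x)%:E| `^ 1)) `^ 1^-1 <= C%:E)%E <->
  (\int[mu]_(x in `[(x0 - rho)%R, (x0 + rho)%R]) `|brjuno x - (h x)%:E|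
    <= (2 * rho * C)%:E)%E.
Proof.
move=> r0; have r20 : 0 < 2 * rho by rewrite mulr_gt0.
under eq_integral do rewrite poweRe1 ?abse_ge0//.
set I := (\int[mu]_(x in _) _)%E.
have I0 : (0 <= I)%E by apply: integral_ge0.
rewrite invr1 poweRe1; last by rewrite mule_ge0// lee_fin invr_ge0 ltW.
rewrite -[in X in X <-> _](@lee_pmul2l _ (2 * rho)%:E)// muleA -!EFinM.
by rewrite divff ?mul1e// gt_eqF.
Qed.

(** On a ball of radius rho the polynomial differs from its constant term by O(rho), so a constant
    suffices at the price of capping the exponent at 1. The cap is harmless at irrational points,
    where 1/tau <= 1/2. *)
Lemma Tspace_brjuno_const alpha x0 : 0 < alpha -> Tspace 1 alpha x0 brjuno ->
  exists c C e, [/\ 0 < C, 0 < e & forall rho, 0 < rho < e ->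
    (\int[mu]_(x in `[(x0 - rho)%R, (x0 + rho)%R]) `|brjuno x - c%:E|
      <= (C * (rho * rho `^ Num.min alpha 1))%:E)%E].
Proof.
move=> a0 [_ _ [C [P [C0 _ /near_right0P[e e0 H]]]]].
have [M M0 HM] := poly_lipschitz_unit P.
exists P.[0], (2 * (C + M)), (Num.min e 1); split.
- by rewrite mulr_gt0// ltr_pwDl.
- by rewrite lt_min e0 ltr01.
move=> rho /andP[r0]; rewrite lt_min => /andP[re r1].
have r20 : x0 - rho < x0 + rho by lra.
have H1 := (mean_brjunoE (fun x => P.[x - x0]) x0 rho (C * rho `^ alpha) r0).1 (H rho _).
have {}H1 := H1 (introT andP (conj r0 re)).
pose F x := (`|brjuno x - (P.[x - x0])%:E| + (M * rho)%:E)%E.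
have mF : measurable_fun setT (fun x => `|brjuno x - (P.[x - x0])%:E|%E).
  exact: (measurable_brjunoB (fun x => P.[x - x0]) (measurable_poly_shift P x0)).
have Mr0 : 0 <= M * rho by rewrite mulr_ge0// ltW.
apply: (@le_trans _ _ (\int[mu]_(x in `[(x0 - rho)%R, (x0 + rho)%R]) F x)%E).
  apply: ge0_le_integral => //.
  - exact: measurable_funTS (measurable_brjunoB _ (measurable_cst _)).
  - by apply: measurable_funTS; apply: emeasurable_funD.
  move=> x; rewrite /= in_itv/= => /andP[x1 x2].
  have xr : `|x - x0| <= rho by rewrite ler_norml; apply/andP; split; lra.
  have Px : `|P.[x - x0] - P.[0]| <= M * rho.
    apply: le_trans (HM _ _) _; first by apply: le_trans xr _; exact: ltW.
    by rewrite ler_wpM2l.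
  rewrite /F; case: (brjuno x) => [z||]; rewrite /= ?leey//.
  rewrite lee_fin; have := ler_normD (z - P.[x - x0]) (P.[x - x0] - P.[0]).
  by rewrite subrKA; lra.
rewrite ge0_integralD//; last exact: measurable_funTS.
rewrite integral_cst_itv//; apply: le_trans (leeD2r _ H1) _.
rewrite -EFinD lee_fin.
have rb : 0 <= rho `^ Num.min alpha 1 by exact: powR_ge0.
have h1 : rho `^ alpha <= rho `^ Num.min alpha 1.
  by apply: ger_powR; [rewrite r0 ltW|rewrite ge_min lexx].
have h2 : rho <= rho `^ Num.min alpha 1.
  rewrite -{1}(powRr1 (ltW r0)).
  by apply: ger_powR; [rewrite r0 ltW|rewrite ge_min lexx orbT].
move: h1 h2; set u := rho `^ alpha; set w := rho `^ _ => h1 h2.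
have -> : 2 * rho * (C * u) + M * rho * (x0 + rho - (x0 - rho)) = 2 * rho * (C * u + M * rho) by ring.
have -> : 2 * (C + M) * (rho * w) = 2 * rho * (C * w + M * w) by ring.
by rewrite ler_pM2l ?mulr_gt0// lerD// ler_wpM2l// ltW.
Qed.

Lemma cf_den_ge_nat x n : irrational x -> n%:R <= (cf_den x n.+1)%:~R :> R.
Proof.
move=> ix; elim: n => [|[|n] IH].
- by apply: cf_den_ge0; exact: irrational_good.
- by apply: cf_denS_ge1; exact: irrational_good.
have := cf_denSS x n.+1 (irrational_good _ _ ix).
have := cf_denS_ge1 x n (irrational_good _ _ ix).
by rewrite -[n.+2%:R]natr1; lra.
Qed.

Lemma cf_tau_gtE x n t : irrational x -> (1 < n)%N ->
  (t < cf_tau x n) = (cf_err x n.+1 / (cf_den x n.+1)%:~R < (cf_den x n.+1)%:~R `^ (- t)).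
Proof.
move=> ix n1; have q2 : 1 < (cf_den x n.+1)%:~R :> R.
  by apply: lt_le_trans (cf_den_ge_nat x n ix); rewrite ltr1n.
rewrite /cf_tau cf_err_dist//; set q : R := _%:~R in q2 *.
have q0 : 0 < q by exact: lt_trans q2.
have d0 : 0 < cf_err x n.+1 / q by rewrite divr_gt0// irrational_err_gt0.
rewrite -[RHS]ltr_ln ?posrE ?powR_gt0// ln_powR mulNr ltrNr -mulNr.
by rewrite ltr_pdivrMr ?ln_gt0// mulNr.
Qed.

Lemma cf_tau_ltE x n t : irrational x -> (1 < n)%N ->
  (cf_tau x n < t) = ((cf_den x n.+1)%:~R `^ (- t) < cf_err x n.+1 / (cf_den x n.+1)%:~R).
Proof.
move=> ix n1; have q2 : 1 < (cf_den x n.+1)%:~R :> R.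
  by apply: lt_le_trans (cf_den_ge_nat x n ix); rewrite ltr1n.
rewrite /cf_tau cf_err_dist//; set q : R := _%:~R in q2 *.
have q0 : 0 < q by exact: lt_trans q2.
have d0 : 0 < cf_err x n.+1 / q by rewrite divr_gt0// irrational_err_gt0.
rewrite -[RHS]ltr_ln ?posrE ?powR_gt0// ln_powR ltrNl.
by rewrite ltr_pdivlMr ?ln_gt0// mulNr.
Qed.

Lemma frequently_cf_tau x (t : R) N : (t%:E < irrationality_exponent x)%E ->
  exists2 n, (N <= n)%N & t < cf_tau x n.
Proof.
move=> tx; have : (t%:E < ereal_sup [set (cf_tau x n)%:E | n in [set n | (N <= n)%N]])%E.
  apply: lt_le_trans tx _; apply: ereal_inf_lbound.
  by exists [set n | (N <= n)%N] => //; exists N.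
by move=> /ereal_sup_gt[_ [n Nn <-]]; rewrite lte_fin => h; exists n.
Qed.

Lemma eventually_cf_tau x (t : R) : (irrationality_exponent x < t%:E)%E ->
  exists N, forall n, (N <= n)%N -> cf_tau x n < t.
Proof.
move=> /ereal_inf_lt[_ [V [N _ NV] <-]] h; exists N => n Nn.
rewrite -lte_fin; apply: le_lt_trans h; apply: ereal_sup_ubound.
by exists n => //; exact: NV.
Qed.

(** Every convergent satisfies |x - p_n/q_n| <= 1/q_n^2, since e_(n+1) <= 1/q_(n+1) <= 1/q_n. *)
Lemma irrationality_exponent_ge2 x : irrational x -> (2%:E <= irrationality_exponent x)%E.
Proof.
move=> ix; rewrite leNgt; apply/negP => /eventually_cf_tau[N H].
have := H (maxn N 2) (leq_maxl _ _); set n := maxn N 2.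
have n1 : (1 < n)%N by rewrite leq_max orbT.
rewrite cf_tau_ltE//; apply/negP; rewrite -leNgt.
have g := irrational_good x n.+2 ix.
have := cf_den_err_le1 _ _ g; have := cf_den_le x n.+1 (cf_good_sub _ _ _ (leqnSn _) g).
have := cf_denS_ge1 x n (cf_good_sub _ _ _ (ltnW (leqnSn _)) g).
have := cf_err_ge0 x n.+1; set q : R := (cf_den x n.+1)%:~R; set q' : R := (cf_den x n.+2)%:~R.
set e := cf_err _ _ => e0 q1 qq q'e.
have q0 : 0 < q by exact: lt_le_trans q1.
rewrite powRN powR_mulrn ?(ltW q0)// ler_pdivrMr//.
have -> : q ^- 2 * q = q^-1 by field; exact: lt0r_neq0.
rewrite -div1r ler_pdivlMr// mulrC; apply: le_trans q'e.
by rewrite ler_wpM2r.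
Qed.

(** * Rational points and their last convergent *)

Lemma cf_err_even_le x k : cf_good x k.*2 -> cf_err x k.*2 * 2 ^+ k <= 1.
Proof.
elim: k => [|k IH g]; first by rewrite cf_err0 expr0 mulr1.
rewrite doubleS in g *; have /IH := cf_good_sub _ _ _ (leqW (leqnSn _)) g.
apply: le_trans; rewrite exprS mulrA ler_pM2r ?exprn_gt0// mulrC mulr_natl.
exact: cf_errSS_half.
Qed.

(** For x = a/b each error is a multiple of 1/b. If no remainder vanished, the errors would stay
    positive, while the one of index 2b is at most 2^-b < 1/b. *)
Lemma rational_cf_rest0 x : rational x -> exists n, cf_rest x n == 0.
Proof.
move=> /rationalP[a [b xab]]; apply: contrapT => nex.
have g n : cf_good x n.
  move=> j _; have /andP[r0 _] := cf_rest_itv x j; rewrite lt_neqAle r0 andbT eq_sym.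
  by apply/negP => h; apply: nex; exists j.
have [b0|b0] := eqVneq b 0%N.
  by apply: nex; exists 0%N; rewrite xab b0 invr0 mulr0 /cf_rest/= /fracpart floor0 subrr.
have bp : 0 < b%:R :> R by rewrite ltr0n lt0n.
have e0 := cf_err_gt0 _ _ (g b.*2).
have : 1 <= cf_err x b.*2 * b%:R.
  have : cf_err x b.*2 * b%:R = `|(cf_num x b.*2 * b%:Z - cf_den x b.*2 * a)%:~R|.
    rewrite /cf_err {3}xab -[X in _ * X = _](gtr0_norm bp) -normrM; congr `|_|.
    rewrite intrB !intrM -!pmulrn. field; exact: lt0r_neq0.
  move=> E; move: (E) => ->; rewrite -intr_norm ler1z -gtz0_ge1 normr_gt0.
  apply/eqP => z0; move: E; rewrite z0 normr0 => /eqP.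
  by rewrite mulf_eq0 !gt_eqF.
have := cf_err_even_le x b (g b.*2).
have : b%:R < 2 ^+ b :> R by rewrite -natrX ltr_nat ltn_expl.
by rewrite -(ltr_pM2l e0); lra.
Qed.

(** At the first vanishing remainder, of index n, the error of p_n/q_n is zero. *)
Lemma rational_convergent x : rational x -> exists2 n, cf_good x n &
  x = (cf_num x n.+1)%:~R / (cf_den x n.+1)%:~R.
Proof.
move=> /rational_cf_rest0 ex; case: (ex_minnP ex) => n /eqP rn minn.
have g : cf_good x n.
  move=> j jn; have /andP[r0 _] := cf_rest_itv x j; rewrite lt_neqAle r0 andbT eq_sym.
  by apply/negP => /minn; rewrite leqNgt jn.
exists n => //; have [_] := signed_err_self_pair x n g.
rewrite big_ord_recr/= rn mulr0 /signed_err => /eqP; rewrite mulf_eq0 signr_eq0/= subr_eq0 => /eqP ->.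
by rewrite mulrAC divff ?mul1r// gt_eqF// (lt_le_trans _ (cf_denS_ge1 x n g)).
Qed.

Lemma powR_small (beta K : R) : 0 < beta -> 0 < K ->
  exists2 e, 0 < e & forall rho, 0 < rho < e -> rho `^ beta < K.
Proof.
move=> b0 K0; exists (K `^ beta^-1); first exact: powR_gt0.
move=> rho /andP[r0 rK]; have -> : K = (K `^ beta^-1) `^ beta.
  by rewrite -powRrM mulVf ?gt_eqF// powRr1// ltW.
by apply: gt0_ltr_powR; rewrite ?nnegrE ?powR_ge0 ?ltW.
Qed.

(** From here on only the existence of a threshold in (0,1] matters, so its numerical value is
    hidden. *)
Lemma brjuno_oscillation_ex : exists k : R, [/\ 0 < k, k <= 1 &
  forall x0 n r a b c, cf_good x0 n -> 0 < r ->
    r * (cf_den x0 n.+1)%:~R * (cf_den x0 n.+1)%:~R <= k ->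
    a <= (cf_num x0 n.+1)%:~R / (cf_den x0 n.+1)%:~R - r ->
    (cf_num x0 n.+1)%:~R / (cf_den x0 n.+1)%:~R + r <= b ->
    ((r / (cf_den x0 n.+1)%:~R / 16)%:E <=
      \int[mu]_(x in `[a, b]) `|brjuno x - c%:E|)%E].
Proof. by exists 2048^-1; split; [lra|lra|exact: brjuno_oscillation]. Qed.

(** Around [x0], its own last convergent, the integrated oscillation at radius rho is of order rho/q
    with [q] fixed, against an assumed bound of order rho^(1 + min(alpha, 1)). *)
Lemma Tspace_brjuno_rational x0 alpha : rational x0 -> 0 < alpha ->
  ~ Tspace 1 alpha x0 brjuno.
Proof.
move=> /rational_convergent[n g x0E] a0 /(Tspace_brjuno_const _ _ a0)[c [C [e [C0 e0 H]]]].
have q1 := cf_denS_ge1 x0 n g; set q : R := (cf_den x0 n.+1)%:~R in q1 *.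
have q0 : 0 < q by exact: lt_le_trans q1.
have b0 : 0 < Num.min alpha 1 by rewrite lt_min a0 ltr01.
have K0 : 0 < (C * (q * 16))^-1 by rewrite invr_gt0 !mulr_gt0.
have [e' e'0 He'] := powR_small _ _ b0 K0.
have [k [k0 _ osc]] := brjuno_oscillation_ex.
have [S S0 Sq] : exists2 S, 0 < S & S * q * q <= k.
  exists (k / q / q); first by rewrite !divr_gt0.
  by rewrite !divfK ?gt_eqF.
pose m := Num.min S (Num.min e e'); have m0 : 0 < m by rewrite !lt_min S0 e0.
have mr : m / 2 < m by rewrite ltr_pdivrMr// ltr_pMr// ltr1n.
have r0 : 0 < m / 2 by rewrite divr_gt0.
move: mr r0; set rho := m / 2; rewrite !lt_min => /and3P[rS re re'] r0.
have := H rho; rewrite r0 re => /(_ isT) H1.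
have H2 : rho * q * q <= k.
  by apply: le_trans Sq; rewrite !ler_pM2r// ltW.
have := osc x0 n rho (x0 - rho) (x0 + rho) c g r0 H2.
rewrite -x0E => /(_ (lexx _) (lexx _)) /le_trans /(_ H1).
have := He' rho; rewrite r0 re' => /(_ isT).
set w := rho `^ _ => wK; rewrite lee_fin -/q; apply/negP; rewrite -ltNge.
rewrite mulrCA -mulrA ltr_pM2l// -invfM -ltr_pdivlMl//.
by rewrite -invfM.
Qed.

(** * Irrational points: exponents above 1/tau are excluded *)

Lemma lt_EFin_between (a : R) (z : \bar R) : (a%:E < z)%E ->
  exists2 t, a < t & (t%:E < z)%E.
Proof.
case: z => [z||//]; last by move=> _; exists (a + 1); rewrite ?ltry// ltrDl.
by rewrite lte_fin => az; exists ((a + z) / 2); rewrite ?lte_fin; lra.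
Qed.

Lemma Tspace_brjuno_irrational x0 alpha : irrational x0 ->
  ((irrationality_exponent x0)^-1 < alpha%:E)%E -> ~ Tspace 1 alpha x0 brjuno.
Proof.
move=> ix tau_alpha.
have tau2 := irrationality_exponent_ge2 x0 ix.
have tau0 : (0 <= irrationality_exponent x0)%E by apply: le_trans tau2; rewrite lee_fin.
have a0 : 0 < alpha by rewrite -lte_fin; apply: le_lt_trans tau_alpha; rewrite inve_ge0.
move=> /(Tspace_brjuno_const _ _ a0)[c [C [e [C0 e0 H]]]].
set beta := Num.min alpha 1 in H.
have b0 : 0 < beta by rewrite lt_min a0 ltr01.
(* For [alpha > 1] the cap gives [beta] = 1, which still exceeds 1/tau because tau >= 2. *)
have : (beta^-1%:E < irrationality_exponent x0)%E.
  rewrite /beta; have [a1|a1] := leP alpha 1.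
    move: tau_alpha; rewrite inve_plt ?inE//; last by rewrite lee_fin ltW.
    by rewrite inver gt_eqF.
  by apply: lt_le_trans tau2; rewrite invr1 lte_fin ltr1n.
move=> /lt_EFin_between[t bt tt].
have t0 : 0 < t by apply: lt_trans bt; rewrite invr_gt0.
(* The gain of d <= q^-t over the critical rate: d^beta <= q^-1 q^-s. *)
pose s := t * beta - 1; have s0 : 0 < s.
  by rewrite subr_gt0 -ltr_pdivrMr// div1r.
have [e1 e10 He1] := powR_small 1 (e / 2) ltr01 (divr_gt0 e0 (ltr0n _ 2)).
have [k [k0 k1 osc]] := brjuno_oscillation_ex.
have C2 : 0 < C * 2 `^ beta * 2 by rewrite !mulr_gt0// powR_gt0.
have K0 : 0 < k / 16 / (C * 2 `^ beta * 2) by rewrite !divr_gt0.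
have [e2 e20 He2] := powR_small s _ s0 K0.
(* Since q_n >= n, an index above [M] puts the radius 2d below [e] and q^-1 below [e2]. *)
pose M := Num.trunc (Num.max (e / 2)^-1 e2^-1).
have [n Nn tn] := frequently_cf_tau x0 t (maxn 2 M.+1) tt.
have n1 : (1 < n)%N by apply: leq_trans Nn; rewrite leq_max leqnn.
move: tn; rewrite cf_tau_gtE// => dn.
have qn := cf_den_ge_nat x0 n ix.
have g := irrational_good x0 n ix; have q1 := cf_denS_ge1 x0 n g.
have qe := cf_den_err_le1 _ _ (irrational_good x0 n.+2 ix).
have qq := cf_den_le _ _ (irrational_good x0 n.+1 ix).
have v0 := cf_err_dist x0 n ix.
have er0 := irrational_err_gt0 x0 n.+1 ix.
set q : R := (cf_den x0 n.+1)%:~R in q1 qn dn qq v0 *.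
set v := _ / q in v0.
have q0 : 0 < q by exact: lt_le_trans q1.
have Mq : Num.max (e / 2)^-1 e2^-1 < q.
  have m0 : 0 <= Num.max (e / 2)^-1 e2^-1 by rewrite le_max invr_ge0 ltW// divr_gt0.
  have /andP[_ h] := truncn_itv m0; apply: lt_le_trans h _; apply: le_trans qn.
  by rewrite ler_nat; apply: leq_trans Nn; rewrite leq_max leqnn orbT.
move: Mq; rewrite gt_max => /andP[Me Me2].
set d := cf_err x0 n.+1 / q in v0 dn.
have d0 : 0 < d by rewrite divr_gt0.
have dq : d * q * q <= 1.
  rewrite /d divfK ?gt_eqF// mulrC; apply: le_trans qe.
  by rewrite ler_pM2r.
have dinv : d <= q^-1.
  rewrite -div1r ler_pdivlMr//; apply: le_trans dq.
  by rewrite ler_peMr// mulr_ge0// ltW.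
have d2e : 2 * d < e.
  rewrite mulrC -ltr_pdivlMr//; apply: le_lt_trans dinv _.
  by rewrite -[ltRHS]invrK ltf_pV2 ?posrE ?invr_gt0 ?divr_gt0.
have := H (2 * d); rewrite d2e mulr_gt0// => /(_ isT) H1.
(* The interval of radius [r] around [v] fits into the one of radius 2d around [x0], and d q^2 <= 1
   brings r q^2 below the threshold of the oscillation bound. *)
pose r := k * d; have r0 : 0 < r by rewrite mulr_gt0.
have r1 : r * q * q <= k.
  rewrite /r (_ : k * d * q * q = k * (d * q * q)); last by ring.
  by rewrite ler_piMr// ltW.
have rd : r <= d by rewrite /r ler_piMl// ltW.
have vx : `|x0 - v| <= d by rewrite v0.
move: vx; rewrite ler_norml => /andP[vx1 vx2].
have va : x0 - 2 * d <= v - r by clear -rd vx1 vx2; lra.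
have vb : v + r <= x0 + 2 * d by clear -rd vx1 vx2; lra.
have := osc x0 n r _ _ c g r0 r1 va vb.
move=> /le_trans /(_ H1); rewrite lee_fin -/q; apply/negP; rewrite -ltNge.
have dt : d `^ beta <= q^-1 * q `^ (- s).
  have -> : q^-1 * q `^ (- s) = (q `^ (- t)) `^ beta.
    rewrite -powRrM -(powR_inv1 (ltW q0)) -powRD; last first.
      by rewrite (gt_eqF q0) implybT.
    by congr (_ `^ _); rewrite /s; ring.
  by apply: ge0_ler_powR; rewrite ?nnegrE ?powR_ge0 ?ltW.
have qs : q `^ (- s) < k / 16 / (C * 2 `^ beta * 2).
  rewrite powRN -powR_inv1 ?powR_ge0// -powRrM mulrN1 -[- s]mulN1r powRrM powR_inv1 ?(ltW q0)//.
  by apply: He2; rewrite invr_gt0 q0 -[ltRHS]invrK ltf_pV2 ?posrE ?invr_gt0.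
rewrite powRM ?(ltW d0)//.
have -> : r / q / 16 = d * (q^-1 * (k / 16)).
  by rewrite /r; field; exact: lt0r_neq0.
have -> : C * (2 * d * (2 `^ beta * d `^ beta)) = d * (C * 2 `^ beta * 2 * d `^ beta) by ring.
rewrite ltr_pM2l//; apply: (@le_lt_trans _ _ (C * 2 `^ beta * 2 * (q^-1 * q `^ (- s)))).
  by rewrite ler_pM2l.
by rewrite mulrCA ltr_pM2l ?invr_gt0// mulrC -ltr_pdivlMr.
Qed.

End irregularity.

(** * Averages around an arbitrary point *)

Section regularity.
Context {R : realType}.
Implicit Types (a b c r x y alpha rho : R) (k m n : nat).
Local Notation mu := (@lebesgue_measure R).

Lemma ln2_ge : 1 / 2 <= ln (2 : R).
Proof.
have := @le_ln1Dx R (- (1 / 2)); rewrite (_ : 1 + - (1 / 2) = 2^-1); last by field.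
by rewrite lnV ?posrE// => h; have := h (_ : _); lra.
Qed.

Lemma ln_le_powR (y s : R) : 0 < y -> 0 < s -> ln y <= s^-1 * y `^ s.
Proof.
move=> y0 s0; rewrite ler_pdivlMl// -ln_powR ltW// ln_sublinear// powR_gt0//.
Qed.

(** The least [K] is at most 1 + 2 ln (1/rho), which a power rho^-s absorbs; 52 is the constant of
    the block estimate. *)
Lemma dyadic_scale (s : R) : 0 < s -> exists2 C, 0 < C & forall rho, 0 < rho <= 1 ->
  exists2 K, 2 ^- K <= rho & K%:R + 52 <= C * rho `^ (- s).
Proof.
move=> s0; exists (53 + 2 / s); first by rewrite addr_gt0// divr_gt0.
move=> rho /andP[r0 r1].
have ir1 : 1 <= rho^-1 by rewrite invf_ge1.
have ex : exists K, rho^-1 <= 2 ^+ K.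
  exists (Num.trunc rho^-1).+1; apply: (@le_trans _ _ (Num.trunc rho^-1).+1%:R).
    by have /andP[_ /ltW] := truncn_itv (le_trans ler01 ir1).
  by rewrite -natrX ler_nat ltnW// ltn_expl.
case: (ex_minnP ex) => K HK minK; exists K.
  by rewrite -[leRHS]invrK lef_pV2 ?posrE ?exprn_gt0 ?invr_gt0.
have ps : rho `^ (- s) = rho^-1 `^ s by rewrite -powR_inv1 ?(ltW r0)// -powRrM mulN1r.
have p1 : 1 <= rho^-1 `^ s.
  by rewrite -[leLHS](powRr0 rho^-1) ler_powR// ltW.
have K1 : K%:R <= 1 + 2 * ln (rho^-1).
  case: K HK minK => [_ _|K _ minK].
    by rewrite addr_ge0// mulr_ge0// ln_ge0.
  have : 2 ^+ K <= rho^-1.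
    by rewrite leNgt; apply/negP => /ltW/minK; rewrite ltnn.
  rewrite -ler_ln ?posrE ?exprn_gt0 ?invr_gt0// lnXn// => h.
  have h2 : (1 / 2 : R) *+ K <= ln 2 *+ K by rewrite lerMn2r ln2_ge orbT.
  have -> : K.+1%:R = 1 + 2 * ((1 / 2) *+ K) :> R by rewrite -natr1 -mulrnAr; field.
  by clear -h h2; lra.
have := ln_le_powR rho^-1 s; rewrite invr_gt0 => /(_ r0 s0).
rewrite ps mulrDl -mulrA; set w := rho^-1 `^ s in p1 *; set z := ln _ in K1 * => h.
by move: K1; lra.
Qed.

(** The zero polynomial works: the mean over a small interval is O(ln (1/rho)), which any negative
    power dominates. *)
Lemma Tspace_brjuno_neg x0 alpha : -1 <= alpha -> alpha < 0 -> Tspace 1 alpha x0 brjuno.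
Proof.
move=> a1 a0; split; [exact: Lp_loc_brjuno|by rewrite invr1|].
have na0 : 0 < - alpha by rewrite oppr_gt0.
have [C C0 HC] := dyadic_scale _ na0.
exists (C *+ 4), 0; split; [by rewrite pmulrn_lgt0|by left|].
apply/near_right0P; exists 1 => // rho /andP[r0 r1].
apply/(mean_brjunoE (fun x => (0 : {poly R}).[x - x0]) x0 rho _ r0).
under eq_integral do rewrite horner0 sube0 gee0_abs ?brjuno_ge0//.
have [|K K1 K2] := HC rho; first by rewrite r0 ltW.
rewrite opprK in K2.
apply: le_trans (brjuno_integral_le _ _ K _ _) _.
- by lra.
- by lra.
rewrite lee_fin; have -> : x0 + rho - (x0 - rho) = 2 * rho by ring.
have -> : 2 * rho * (C *+ 4 * rho `^ alpha) = (2 * rho * (C * rho `^ alpha)) *+ 4 by ring.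
by rewrite lerMn2r/= ler_pM2l// mulr_gt0.
Qed.

Lemma signed_err_near x0 k x rho : cf_good x0 k -> `|x - x0| <= rho ->
  `|signed_err x0 k x - cf_err x0 k| <= (cf_den x0 k)%:~R * rho.
Proof.
move=> g xr; rewrite (cf_err_signed _ _ g) signed_errB !normrM normrX normrN1 expr1n mul1r.
by rewrite (ger0_norm (cf_den_ge0 _ _ g)) distrC ler_wpM2l// cf_den_ge0.
Qed.

(** On the ball each signed error moves by at most its denominator times [rho]; the hypotheses leave
    room for both cylinder inequalities. *)
Lemma near_cylinder x0 m rho x : cf_good x0 m.+1 -> `|x - x0| <= rho ->
  (cf_den x0 m.+1)%:~R * rho < cf_err x0 m.+1 ->
  ((cf_den x0 m)%:~R + (cf_den x0 m.+1)%:~R) * rho < cf_err x0 m - cf_err x0 m.+1 ->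
  forall k, (k <= m.+1)%N -> cf_num x k = cf_num x0 k /\ cf_den x k = cf_den x0 k.
Proof.
move=> g xr h1 h2; have g' := cf_good_sub _ _ _ (leqnSn m) g.
apply: cylinder_num_den => //.
have := signed_err_near x0 m x rho g' xr; have := signed_err_near x0 m.+1 x rho g xr.
rewrite !ler_norml => /andP[h3 h4] /andP[h5 h6]; apply/andP; split; first lra.
by rewrite mulrDl in h2; lra.
Qed.

(** The deviation splits into the Lipschitz part of the partial sum, the tail at [x0], and the tail
    at the moving point, which is averaged through its majorant. *)
Lemma brjuno_mean_le x0 m rho K (T0 : R) : irrational x0 -> 0 < rho ->
  4 * rho * (cf_den x0 m.+1)%:~R <= cf_err x0 m.+1 ->
  cf_err x0 m.+1 <= 2 / 5 ->
  (forall x, `|x - x0| <= rho ->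
    forall k, (k <= m.+1)%N -> cf_num x k = cf_num x0 k /\ cf_den x k = cf_den x0 k) ->
  (brjuno_tail x0 m.+1 <= T0%:E)%E -> 2 ^- K <= rho ->
  (\int[mu]_(x in `[(x0 - rho)%R, (x0 + rho)%R]) `|brjuno x - (fine (brjuno x0))%:E|
    <= (2 * rho * (36 * (rho / cf_err x0 m.+1) + T0 +
          10 * ((K%:R + 52) * cf_err x0 m.+1)))%:E)%E.
Proof.
move=> ix r0 h4 X25 sh tT HK.
have X0 := irrational_err_gt0 x0 m.+1 ix.
have er x : irrational x -> `|x - x0| <= rho ->
    3 / 4 * cf_err x0 m.+1 <= cf_err x m.+1 <= 5 / 4 * cf_err x0 m.+1.
  move=> ix' xr; have [En Ed] := sh x xr m.+1 (leqnn _).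
  have := cf_errB x x0 m.+1 ix' ix En Ed; rewrite Ed => E.
  have : `|cf_err x m.+1 - cf_err x0 m.+1| <= cf_err x0 m.+1 / 4.
    rewrite E; apply: (@le_trans _ _ ((cf_den x0 m.+1)%:~R * rho)).
      by rewrite ler_wpM2l// cf_den_ge0//; exact: irrational_good.
    by clear -h4; lra.
  by rewrite ler_norml => /andP[u1 u2]; clear -u1 u2; apply/andP; split; lra.
have lip x : irrational x -> `|x - x0| <= rho ->
    `|brjuno_sum x m.+1 - brjuno_sum x0 m.+1| <= 36 * (rho / cf_err x0 m.+1).
  move=> ix' xr; apply: le_trans (brjuno_sum_lip x x0 m.+1 ix' ix (sh x xr)) _.
  have /andP[e1 _] := er x ix' xr.
  (* The two inverse errors add up to at most 7/3 <= 3 times the one at [x0], and 36 = 12 * 3. *)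
  have iX : (cf_err x m.+1)^-1 <= 4 / 3 * (cf_err x0 m.+1)^-1.
    have -> : 4 / 3 * (cf_err x0 m.+1)^-1 = (3 / 4 * cf_err x0 m.+1)^-1.
      by field; exact: lt0r_neq0.
    by rewrite lef_pV2 ?posrE ?irrational_err_gt0// mulr_gt0.
  have -> : 36 * (rho / cf_err x0 m.+1) = (rho * (3 * (cf_err x0 m.+1)^-1)) *+ 12 by ring.
  rewrite lerMn2r/=; apply: ler_pM => //; first by rewrite addr_ge0// invr_ge0 cf_err_ge0.
  have : 0 < (cf_err x0 m.+1)^-1 by rewrite invr_gt0.
  by clear -iX; lra.
have lip0 : 0 <= 36 * (rho / cf_err x0 m.+1).
  by rewrite mulr_ge0// divr_ge0 ?(ltW r0) ?(ltW X0).
set L := 36 * _ in lip lip0 *; set X := cf_err x0 m.+1 in h4 X25 X0 er *.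
(* At nearby points the error e is at most 5X/4, and 1 <= 2 q e bounds the next denominator q below
   by [Q]; X <= 2/5 makes [Q] at least 1. The final factor 10 X is 4/Q. *)
pose Q := 2 / (5 * X).
have Q1 : 1 <= Q by rewrite /Q ler_pdivlMr ?mulr_gt0//; clear -X25; lra.
have ab : x0 - rho < x0 + rho by clear -r0; lra.
have Q2 : 2 ^- K <= Q ^+ 2 * (x0 + rho - (x0 - rho)).
  apply: le_trans HK _; rewrite (_ : x0 + rho - (x0 - rho) = 2 * rho); last by ring.
  rewrite mulrA ler_peMl ?(ltW r0)//.
  have : 1 <= Q ^+ 2 by exact: exprn_ege1.
  by clear; lra.
have [G [mG G0 tG iG]] := brjuno_tail_dominated (x0 - rho) (x0 + rho) Q K ab Q1 Q2.
have T00 := brjuno_tail_ge0 x0 m.+1 ix.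
have tfin : brjuno_tail x0 m.+1 \is a fin_num.
  by rewrite ge0_fin_numE// (le_lt_trans tT)// ltry.
have T0r : 0 <= fine (brjuno_tail x0 m.+1) <= T0.
  by rewrite fine_ge0//= -lee_fin fineK.
have -> : fine (brjuno x0) = brjuno_sum x0 m.+1 + fine (brjuno_tail x0 m.+1).
  by rewrite (brjunoE x0 m.+1 ix) fineD.
set t0 := fine _ in T0r *; move: T0r => /andP[t00 t0T].
have T0p : 0 <= T0 by exact: le_trans t0T.
apply: (@le_trans _ _ (\int[mu]_(x in `[(x0 - rho)%R, (x0 + rho)%R]) ((L + T0)%:E + G x))%E).
  apply: ge0_le_integral_irrational => //.
  - exact: measurable_brjunoB (measurable_cst _).
  - by move=> x; rewrite adde_ge0// lee_fin addr_ge0.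
  - exact: emeasurable_funD.
  move=> x; rewrite /= in_itv/= => xI ix'.
  have xr : `|x - x0| <= rho.
    by move: xI => /andP[? ?]; rewrite ler_norml; apply/andP; split; lra.
  have Qx : Q <= (cf_den x m.+2)%:~R.
    have g' := irrational_good x m.+2 ix'.
    have := cf_den_err_ge _ _ g'; have /andP[_] := er x ix' xr.
    have : 0 <= (cf_den x m.+2)%:~R :> R by apply: cf_den_ge0; exact: irrational_good.
    set q : R := (cf_den x m.+2)%:~R; set e := cf_err x m.+1 => q0 e1 qe.
    rewrite /Q ler_pdivrMr ?mulr_gt0//.
    have : q * e <= q * (5 / 4 * X) by rewrite ler_wpM2l.
    by clear -qe; lra.
  have := tG x m.+1 ix' xI Qx; have := brjuno_tail_ge0 x m.+1 ix'; have := lip x ix' xr.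
  rewrite (brjunoE x m.+1 ix').
  (* An infinite tail forces [G] to be infinite, so the bound is trivial there. *)
  case: (brjuno_tail x m.+1) => [z||//]; last first.
    by move=> _ _; rewrite leye_eq => /eqP ->; rewrite addey ?leey.
  rewrite lee_fin => l1 z0.
  case: (G x) => [gx||//]; last by move=> _; rewrite addey ?leey.
  rewrite lee_fin => zg; rewrite /= lee_fin.
  by move: l1; rewrite !ler_norml => /andP[l1 l2]; clear -l1 l2 z0 zg t00 t0T; apply/andP; split; lra.
rewrite ge0_integralD//; last exact: measurable_funTS.
- rewrite integral_cst_itv//; apply: le_trans (leeD2l _ iG) _.
  rewrite -EFinD lee_fin (_ : x0 + rho - (x0 - rho) = 2 * rho); last by ring.
  rewrite le_eqVlt; apply/orP; left; apply/eqP; rewrite /Q; field.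
  by rewrite lt0r_neq0.
- by move=> x _; rewrite lee_fin addr_ge0.
Qed.

End regularity.

(** * Lower bounds on the exponent *)

Section exponent.
Context {R : realType}.
Implicit Types (a b c r x y alpha rho : R) (k m n : nat).
Local Notation mu := (@lebesgue_measure R).

(** Two interleaved geometric series; after multiplication by [1 - lam] the sum is bounded by a
    telescoping one. *)
Lemma powR_geometric_sum (u : nat -> R) (lam : R) m n : lam < 1 ->
  (forall j, 0 <= u j) -> (forall j, u j.+1 <= u j) -> (forall j, u j.+2 <= lam * u j) ->
  \sum_(j < n) u (j + m)%N <= 2 / (1 - lam) * u m.
Proof.
move=> l1 u0 u1 u2; have l0 : 0 < 1 - lam by rewrite subr_gt0.
rewrite mulrAC ler_pdivlMr//.
suff H : (\sum_(j < n) u (j + m)%N) * (1 - lam) <= u m + u m.+1 - u (n + m)%N - u (n + m).+1.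
  by apply: le_trans H _; have := u1 m; have := u0 (n + m)%N; have := u0 (n + m).+1; lra.
elim: n => [|n IH]; first by rewrite big_ord0 mul0r add0n; lra.
by rewrite big_ord_recr/= mulrDl !addSn; have := u2 (n + m)%N; lra.
Qed.

(** The bound on tau_j together with e_j <= 1/q_j gives ln (e_j/e_(j+1)) <= (t - 2) ln (1/e_j), and
    this logarithm is absorbed into e_j^(s - 1). *)
Lemma brjuno_term_le_pow x j (t s : R) : irrational x -> (1 < j)%N -> 2 < t -> 0 < s < 1 ->
  cf_tau x j < t -> brjuno_term x j <= (t - 2) / (1 - s) * cf_err x j `^ s.
Proof.
move=> ix j1 t2 /andP[s0 s1]; rewrite cf_tau_ltE//.
have g := irrational_good x j ix.
have q1 := cf_denS_ge1 _ _ g; have qe := cf_den_err_le1 _ _ (irrational_good x j.+1 ix).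
set q : R := (cf_den x j.+1)%:~R in q1 qe *.
have q0 : 0 < q by exact: lt_le_trans q1.
have e0 := irrational_err_gt0 x j ix; have e1 := irrational_err_gt0 x j.+1 ix.
move=> h; rewrite /brjuno_term; set e := cf_err x j in qe e0 *; set e' := cf_err x j.+1 in e1 h *.
have l1 : ln (e / e') <= (t - 2) * ln e^-1.
  have lh : - t * ln q < ln e' - ln q.
    by rewrite -ln_powR -ln_div ?posrE// ltr_ln ?posrE ?powR_gt0 ?divr_gt0.
  have lq : ln q <= - ln e.
    by rewrite -lnV ?posrE// ler_ln ?posrE ?invr_gt0// -div1r ler_pdivlMr.
  rewrite ln_div ?posrE// lnV ?posrE//.
  have t1 : 0 <= t - 1 by clear -t2; lra.
  by have := ler_wpM2l t1 lq; clear -lh; lra.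
have l2 : ln e^-1 <= (1 - s)^-1 * e^-1 `^ (1 - s).
  by apply: ln_le_powR; [rewrite invr_gt0|rewrite subr_gt0].
apply: (@le_trans _ _ (e * ((t - 2) * ((1 - s)^-1 * e^-1 `^ (1 - s))))).
  rewrite ler_pM2l//; apply: le_trans l1 _; rewrite ler_wpM2l// subr_ge0 ltW//.
rewrite -(powR_inv1 (ltW e0)) -powRrM mulN1r opprB.
have -> : e * ((t - 2) * ((1 - s)^-1 * e `^ (s - 1))) = (t - 2) / (1 - s) * (e * e `^ (s - 1)) by ring.
by rewrite mulr_powRB1// ltW.
Qed.

(** The powers e_j^s shrink by the factor 2^-s every two steps, so the first one controls the
    tail. *)
Lemma brjuno_tail_le_pow x (t s : R) N : irrational x -> 2 < t -> 0 < s < 1 -> (1 < N)%N ->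
  (forall n, (N <= n)%N -> cf_tau x n < t) ->
  exists2 C, 0 < C & forall m, (N <= m)%N ->
    (brjuno_tail x m <= (C * cf_err x m `^ s)%:E)%E.
Proof.
move=> ix t2 s01 N1 Ht; have /andP[s0 s1] := s01.
pose lam : R := 2^-1 `^ s.
have lam1 : lam < 1.
  rewrite (_ : 1 = 1 `^ s); last by rewrite powR1.
  apply: gt0_ltr_powR => //; rewrite ?nnegrE ?invr_ge0//.
  by rewrite invf_lt1// ltr1n.
pose c := (t - 2) / (1 - s); have c0 : 0 < c by rewrite divr_gt0// subr_gt0.
exists (c * (2 / (1 - lam))); first by rewrite mulr_gt0// divr_gt0// subr_gt0.
move=> m Nm; apply: nneseries_le => [j|n]; first by rewrite lee_fin brjuno_term_ge0.
rewrite sumEFin lee_fin -{1}[m]add0n big_addn big_mkord.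
apply: (@le_trans _ _ (\sum_(j < n - m) c * cf_err x (j + m)%N `^ s)).
  apply: ler_sum => j _; apply: brjuno_term_le_pow => //.
    by apply: leq_trans N1 _; apply: leq_trans Nm (leq_addl _ _).
  by apply: Ht; apply: leq_trans Nm (leq_addl _ _).
rewrite -mulr_sumr -[leRHS]mulrA ler_pM2l//.
apply: (powR_geometric_sum (fun j => cf_err x j `^ s)) => // j.
- exact: powR_ge0.
- apply: ge0_ler_powR; rewrite ?nnegrE ?cf_err_ge0 ?(ltW s0)//.
  by rewrite ltW// irrational_err_lt.
- rewrite /lam -powRM ?invr_ge0 ?cf_err_ge0//.
  apply: ge0_ler_powR; rewrite ?nnegrE ?mulr_ge0 ?invr_ge0 ?cf_err_ge0 ?(ltW s0)//.
  rewrite ler_pdivlMl// mulr_natl; apply: cf_errSS_half; exact: irrational_good.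
Qed.

(* If the digit a_(l+2) is 1, then x0 can be arbitrarily close to the end of its
   cylinder opposite to the convergent, and one digit fewer is shared. *)
Lemma shared_digits_scale x0 rho l : irrational x0 -> 0 < rho ->
  4 * rho * (cf_den x0 l.+2)%:~R < cf_err x0 l.+2 ->
  exists m, [/\ (l <= m)%N, 4 * rho * (cf_den x0 m.+1)%:~R <= cf_err x0 m.+1,
    cf_err x0 l.+2 <= cf_err x0 m.+1, cf_err x0 m.+1 <= 2 / (cf_den x0 l.+3)%:~R &
    forall x, `|x - x0| <= rho ->
      forall k, (k <= m.+1)%N -> cf_num x k = cf_num x0 k /\ cf_den x k = cf_den x0 k].
Proof.
move=> ix r0 H; have g k := irrational_good x0 k ix.
have el k : cf_err x0 k.+1 <= cf_err x0 k by rewrite ltW// irrational_err_lt.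
have dl k : (cf_den x0 k)%:~R <= (cf_den x0 k.+1)%:~R :> R by exact: cf_den_le.
have q0 k : 0 < (cf_den x0 k.+1)%:~R :> R by apply: lt_le_trans (cf_denS_ge1 _ _ (g k)).
have d0 k : 0 <= (cf_den x0 k)%:~R :> R by exact: cf_den_ge0.
have drl k : (cf_den x0 k)%:~R * rho <= (cf_den x0 k.+1)%:~R * rho by rewrite ler_pM2r.
have eq1 k : cf_err x0 k * (cf_den x0 k.+1)%:~R <= 1 by rewrite mulrC cf_den_err_le1.
have a1 k : 1 <= (cf_digit x0 k.+1)%:~R :> R by rewrite ler1z cf_digit_ge1// (g k.+1).
have er k := cf_err_rec x0 k (g k.+2).
have e0 k : 0 < cf_err x0 k by exact: irrational_err_gt0.
have [a2|a2] := leP 2 (cf_digit x0 l.+2).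
- exists l.+1; split=> //; first exact: ltW.
    rewrite ler_pdivlMr//; apply: le_trans (eq1 _) _; clear; lra.
  move=> x xr; apply: near_cylinder (g l.+2) xr _ _.
    by have := d0 l.+2; have := mulr_ge0 (d0 l.+2) (ltW r0); clear -H; lra.
  have : 2 <= (cf_digit x0 l.+2)%:~R :> R by rewrite (_ : 2 = 2%:~R)// ler_int.
  move=> /(ler_wpM2r (ltW (e0 l.+2))); have := er l.+1; have := e0 l.+3; have := drl l.+1.
  have := mulr_ge0 (d0 l.+2) (ltW r0); clear -H; lra.
- have aE : cf_digit x0 l.+2 = 1.
    have := cf_digit_ge1 x0 l.+1 (g l.+2 l.+1 (ltnSn _)); move: a2.
    by set a := cf_digit _ _; lia.
  exists l; split=> //.
  + have := drl l.+1; have := el l.+1; clear -H; lra.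
  + rewrite ler_pdivlMr//.
    (* Here q_(l+2) = q_(l+1) + q_l is at most twice q_(l+1), which accounts for the 2 in the
       bound. *)
    have -> : (cf_den x0 l.+3)%:~R = (cf_den x0 l.+2)%:~R + (cf_den x0 l.+1)%:~R :> R.
      by rewrite -intrD /= -/(cf_digit x0 l.+2) aE mul1r.
    have := eq1 l.+1; have := dl l.+1 => /(ler_wpM2l (ltW (e0 l.+1))); clear; lra.
  move=> x xr; apply: near_cylinder (g l.+1) xr _ _.
    have := drl l.+1; have := el l.+1; have := mulr_ge0 (d0 l.+2) (ltW r0); clear -H; lra.
  have := a1 l => /(ler_wpM2r (ltW (e0 l.+1))); have := er l; have := drl l; have := drl l.+1.
  have := mulr_ge0 (d0 l.+2) (ltW r0); clear -H; lra.
Qed.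

(** The distances to the convergents decrease to zero; k+1 is the first index at which they are at
    most 4 rho. *)
Lemma convergent_scale x0 rho N : irrational x0 -> 0 < rho ->
  4 * rho < cf_err x0 N.+1 / (cf_den x0 N.+1)%:~R ->
  exists k, [/\ (N <= k)%N, 4 * rho < cf_err x0 k.+1 / (cf_den x0 k.+1)%:~R &
    cf_err x0 k.+2 / (cf_den x0 k.+2)%:~R <= 4 * rho].
Proof.
move=> ix r0 H; have g k := irrational_good x0 k ix.
pose d k := cf_err x0 k.+1 / (cf_den x0 k.+1)%:~R.
have q0 k : 0 < (cf_den x0 k.+1)%:~R :> R by apply: lt_le_trans (cf_denS_ge1 _ _ (g k)).
have dS k : d k.+1 <= d k.
  apply: ler_pM; rewrite ?cf_err_ge0 ?invr_ge0 ?(ltW (q0 _))//.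
    by rewrite ltW// irrational_err_lt.
  by rewrite lef_pV2 ?posrE//; exact: cf_den_le.
have dmono k j : d (j + k)%N <= d k.
  by elim: j => [|j IH]//; apply: le_trans IH; exact: dS.
have r40 : 0 < 4 * rho by rewrite mulr_gt0.
have ex : exists n, d n <= 4 * rho.
  exists (Num.trunc (4 * rho)^-1).+1; set n := (Num.trunc _).+1.
  have nq : n%:R <= (cf_den x0 n.+1)%:~R :> R by exact: cf_den_ge_nat.
  have n4 : (4 * rho)^-1 <= n%:R.
    have i0 : 0 <= (4 * rho)^-1 by rewrite invr_ge0 ltW.
    by have /andP[_ /ltW] := truncn_itv i0.
  have e1 : cf_err x0 n.+1 <= 1.
    apply: le_trans (cf_den_err_le1 x0 n.+1 (g _)).
    by rewrite ler_peMl ?cf_err_ge0//; exact: cf_denS_ge1.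
  rewrite ler_pdivrMr//; apply: le_trans e1 _.
  by rewrite -ler_pdivrMl// mulr1; apply: le_trans nq.
case: (ex_minnP ex) => n dn minn.
have Nn : (N < n)%N.
  rewrite ltnNge; apply/negP => nN; move: H; apply/negP; rewrite -leNgt.
  by apply: le_trans dn; rewrite -/(d N) -(subnK nN).
case: n dn minn Nn => [//|k] dk minn Nk; exists k; split=> //.
by rewrite ltNge; apply/negP => /minn; rewrite ltnn.
Qed.

Lemma powR_inv_le (q d t : R) : 0 < q -> 0 < t -> q `^ (- t) <= d -> q^-1 <= d `^ t^-1.
Proof.
move=> q0 t0 qd; have -> : q^-1 = (q `^ (- t)) `^ t^-1.
  by rewrite -powRrM mulNr divff ?gt_eqF// powR_inv1// ltW.
apply: ge0_ler_powR; rewrite ?nnegrE ?invr_ge0 ?powR_ge0 ?(ltW t0)//.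
by apply: le_trans qd; exact: powR_ge0.
Qed.

Lemma Tspace_brjuno_pos x0 alpha (t : R) : irrational x0 ->
  (irrationality_exponent x0 < t%:E)%E -> 0 < alpha -> alpha * t < 1 ->
  Tspace 1 alpha x0 brjuno.
Proof.
move=> ix tau_t a0 at1.
have t2 : 2 < t by rewrite -lte_fin; apply: le_lt_trans tau_t; exact: irrationality_exponent_ge2.
have t0 : 0 < t by apply: lt_trans t2.
have [N0 HN0] := eventually_cf_tau x0 t tau_t.
(* At least 3, so that the errors in use are at most 1/3 and hence at most 2/5. *)
pose N := maxn N0 3.
have HN n : (N <= n)%N -> cf_tau x0 n < t by move=> h; apply: HN0; apply: leq_trans h; exact: leq_maxl.
have N3 : (2 < N)%N by exact: leq_maxr.
pose gam := t^-1; have gam0 : 0 < gam by rewrite invr_gt0.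
have ag : alpha < gam by rewrite /gam -div1r ltr_pdivlMr.
have gam1 : gam <= 1 by rewrite /gam invf_le1// ltW// (lt_trans _ t2)// ltr1n.
(* Chosen so that [gam * s] is [alpha]: the power s of an error of size rho^gam has the order
   rho^alpha. *)
pose s := alpha * t; have s01 : 0 < s < 1 by rewrite mulr_gt0.
have gs : gam * s = alpha by rewrite /gam /s mulrC mulfK// gt_eqF.
have [C1 C10 HC1] := brjuno_tail_le_pow x0 t s N ix t2 s01 (ltnW N3) HN.
have sg0 : 0 < gam - alpha by rewrite subr_gt0.
have [C2 C20 HC2] := dyadic_scale _ sg0.
have g k := irrational_good x0 k ix.
have q0 k : 0 < (cf_den x0 k.+1)%:~R :> R by apply: lt_le_trans (cf_denS_ge1 _ _ (g k)).
have e0 k : 0 < cf_err x0 k by exact: irrational_err_gt0.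
split; [exact: Lp_loc_brjuno|by rewrite invr1; apply: ltW; apply: lt_trans a0; rewrite oppr_lt0|].
pose C := 144 + C1 * 8 `^ s + 80 * C2.
have C0 : 0 < C.
  by rewrite /C !addr_gt0// mulr_gt0// powR_gt0.
exists C, (fine (brjuno x0))%:P; split=> //.
  by right; rewrite size_polyC; case: (_ != 0).
pose dN := cf_err x0 N.+2 / (cf_den x0 N.+2)%:~R.
have dN0 : 0 < dN by rewrite divr_gt0.
apply/near_right0P; exists (Num.min 1 (dN / 4)); first by rewrite lt_min ltr01 divr_gt0.
move=> rho /andP[r0]; rewrite lt_min => /andP[r1 rdN].
apply/(mean_brjunoE (fun x => ((fine (brjuno x0))%:P : {poly R}).[x - x0]) x0 rho _ r0).
under eq_integral do rewrite hornerC.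
have rdN' : 4 * rho < dN by move: rdN; rewrite ltr_pdivlMr// mulrC.
(* Starting at [N.+1] leaves room for the digit that [shared_digits_scale] may lose. *)
have [[|l] [Nk k1 k2]] := convergent_scale x0 rho N.+1 ix r0 rdN'; first by [].
have k1' : 4 * rho * (cf_den x0 l.+2)%:~R < cf_err x0 l.+2 by rewrite -ltr_pdivlMr.
have [m [lm m1 m2 m3 m4]] := shared_digits_scale x0 rho l ix r0 k1'.
have Nl : (N <= l)%N by rewrite -ltnS.
have Nm : (N <= m)%N by exact: leq_trans Nl lm.
have [|K K1 K2] := HC2 rho; first by rewrite r0 ltW.
have X25 : cf_err x0 m.+1 <= 2 / 5.
  have h := cf_den_err_le1 x0 m.+1 (g _).
  have q3 : 3 <= (cf_den x0 m.+2)%:~R :> R.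
    apply: le_trans (cf_den_ge_nat x0 m.+1 ix).
    by rewrite ler_nat; apply: leq_trans N3 _; apply: leq_trans Nm _.
  have : 3 * cf_err x0 m.+1 <= (cf_den x0 m.+2)%:~R * cf_err x0 m.+1 by rewrite ler_pM2r.
  by clear -h; lra.
apply: le_trans (brjuno_mean_le x0 m rho K _ ix r0 m1 X25 m4 (HC1 m.+1 (leqW Nm)) K1) _.
rewrite lee_fin ler_pM2l ?mulr_gt0//.
have r40 : 0 < 4 * rho by rewrite mulr_gt0.
set X := cf_err x0 m.+1 in m1 m2 m3 X25 *.
have X0 : 0 < X by exact: e0.
pose w := (4 * rho) `^ gam.
have w0 : 0 < w by exact: powR_gt0.
(* X <= 2/q_(l+2), and tau_(l+2) < t turns the distance bound 4 rho into q_(l+2)^-1 <= (4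
   rho)^(1/t). *)
have XU : X <= 2 * w.
  apply: le_trans m3 _; rewrite ler_pM2l//; apply: powR_inv_le => //.
  apply: le_trans k2; apply: ltW; rewrite -cf_tau_ltE//.
    by apply: HN; exact: leqW (leqW Nl).
pose dk := cf_err x0 l.+2 / (cf_den x0 l.+2)%:~R.
have dk0 : 0 < dk by rewrite divr_gt0.
have qk : (cf_den x0 l.+2)%:~R^-1 <= dk `^ gam.
  apply: powR_inv_le => //; apply: ltW; rewrite -cf_tau_ltE//.
    by apply: HN; exact: leqW Nl.
  by rewrite ltnS (leq_trans _ Nl)// ltnW// ltnW.
(* The distance [dk] to p_(l+1)/q_(l+1) exceeds 4 rho; rho/X <= rho dk^(gam - 1), and this power
   does not increase with [dk] because gam <= 1. *)
have XV : rho / X <= w.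
  apply: (@le_trans _ _ (rho / cf_err x0 l.+2)).
    by rewrite ler_pM2l// lef_pV2 ?posrE.
  have -> : rho / cf_err x0 l.+2 = (rho / dk) * (cf_den x0 l.+2)%:~R^-1.
    by rewrite /dk; field; rewrite !lt0r_neq0.
  apply: (@le_trans _ _ ((rho / dk) * dk `^ gam)).
    by rewrite ler_pM2l// divr_gt0.
  have dkE : dk = dk `^ (1 - gam) * dk `^ gam.
    by rewrite -powRD ?subrK ?powRr1 ?(ltW dk0)// gt_eqF// implybT.
  have w4 : 4 * rho = (4 * rho) `^ (1 - gam) * w.
    by rewrite /w -powRD ?subrK ?powRr1 ?(ltW r40)// gt_eqF// implybT.
  have h : (4 * rho) `^ (1 - gam) <= dk `^ (1 - gam).
    by apply: ge0_ler_powR; rewrite ?nnegrE ?subr_ge0 ?(ltW r40) ?(ltW dk0)// ltW.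
  rewrite mulrAC ler_pdivrMr// {2}dkE mulrA ler_pM2r ?powR_gt0//.
  apply: (@le_trans _ _ (4 * rho)); first by clear -r0; lra.
  by rewrite w4 mulrC ler_pM2l.
have wr : w <= 4 * rho `^ gam.
  rewrite /w powRM ?(ltW r0)// ler_pM2r ?powR_gt0//.
  by apply: ler1_powR => //; rewrite ler1n.
have ra0 : 0 < rho `^ alpha by exact: powR_gt0.
have rg : rho `^ gam <= rho `^ alpha.
  by apply: ger_powR; [rewrite r0 ltW|exact: ltW].
have B1 : 36 * (rho / X) <= 144 * rho `^ alpha.
  by move: XV wr rg; set u := rho / X; clear; lra.
have B2 : C1 * X `^ s <= C1 * 8 `^ s * rho `^ alpha.
  have -> : rho `^ alpha = (rho `^ gam) `^ s by rewrite -powRrM gs.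
  rewrite -[leRHS]mulrA ler_pM2l// -powRM ?powR_ge0//.
  apply: ge0_ler_powR; first by move: s01 => /andP[/ltW].
  - by rewrite nnegrE ltW.
  - by rewrite nnegrE mulr_ge0// powR_ge0.
  by move: XU wr; clear; lra.
have B3 : 10 * ((K%:R + 52) * X) <= 80 * C2 * rho `^ alpha.
  have KX : (K%:R + 52) * X <= (C2 * rho `^ (- (gam - alpha))) * (8 * rho `^ gam).
    apply: ler_pM => //; first exact: ltW.
    by move: XU wr; clear; lra.
  have rE : rho `^ alpha = rho `^ (- (gam - alpha)) * rho `^ gam.
    rewrite -powRD; last by rewrite (gt_eqF r0) implybT.
    by congr (_ `^ _); ring.
  have -> : 80 * C2 * rho `^ alpha = 10 * ((C2 * rho `^ (- (gam - alpha))) * (8 * rho `^ gam)).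
    by rewrite rE; ring.
  by rewrite ler_pM2l.
by rewrite /C [leRHS]mulrDl [X in _ <= X + _]mulrDl !lerD.
Qed.

End exponent.

(** * The exponent from its lower and upper bounds *)

Theorem theorem1 (R : realType) (x0 : R) :
  (rational x0 -> p_exponent 1 brjuno x0 = 0%E) /\
  (irrational x0 ->
     p_exponent 1 brjuno x0 = ((irrationality_exponent x0)^-1)%E).
Proof.
(* Negative exponents down to -1 are admissible at every point; the minimum with 1 respects that
   limit. *)
have neg_le : (0%E <= p_exponent 1 (@brjuno R) x0)%E.
  apply/lee_subgt0Pr => e e0; rewrite sub0e.
  have m0 : 0 < Num.min e 1 by rewrite lt_min e0 ltr01.
  apply: (@le_trans _ _ (- Num.min e 1)%:E).
    by rewrite lee_fin lerN2 ge_min lexx.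
  apply: ereal_sup_ubound; exists (- Num.min e 1) => //=.
  by apply: Tspace_brjuno_neg; rewrite ?oppr_lt0// lerN2 ge_min lexx orbT.
split=> [qx|ix].
  apply/eqP; rewrite eq_le neg_le andbT; apply: ge_ereal_sup => _ [alpha Ta <-].
  rewrite lee_fin leNgt; apply/negP => a0.
  exact: Tspace_brjuno_rational qx a0 Ta.
have tau2 := irrationality_exponent_ge2 x0 ix.
apply/eqP; rewrite eq_le; apply/andP; split.
  apply: ge_ereal_sup => _ [alpha Ta <-].
  rewrite leNgt; apply/negP => a0.
  exact: Tspace_brjuno_irrational ix a0 Ta.
case tauE : (irrationality_exponent x0) tau2 => [T||//].
  rewrite lee_fin => T2; have T0 : 0 < T by apply: lt_le_trans T2.
  rewrite inver gt_eqF//; apply/lee_subgt0Pr => e e0.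
  have [Te|Te] := leP T^-1 e.
    by apply: le_trans neg_le; rewrite -EFinB lee_fin subr_le0.
  pose alpha := T^-1 - e.
  have a0 : 0 < alpha by rewrite subr_gt0.
  have aT : T < alpha^-1.
    by rewrite -[ltLHS]invrK ltf_pV2 ?posrE ?invr_gt0// gtrBl.
  (* A number strictly between tau and 1/alpha, since the lower bound needs both tau < t and alpha t
     < 1. *)
  pose t := (T + alpha^-1) / 2.
  have tT : T < t by rewrite /t; lra.
  have ta : t < alpha^-1 by rewrite /t; lra.
  apply: ereal_sup_ubound; exists alpha => //=.
  apply: (Tspace_brjuno_pos x0 alpha t) => //; first by rewrite tauE lte_fin.
  by rewrite mulrC -ltr_pdivlMr// div1r.
(* For infinite tau the claimed value is 0, and the negative exponents already give this bound. *)
by move=> _; rewrite invey.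
Qed.
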